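(* Let $k$ be a fixed nonnegative integer. There is a polynomial time algorithm to decide, given a transducer $\boldsymbol{t}$ and an automaton $\boldsymbol{a}$, whether $L(\boldsymbol{a})\in\mathbb{P}_{\boldsymbol{t},k}$.
   Context: An automaton is a nondeterministic finite automaton (NFA); $L(\boldsymbol{a})$ is the language accepted by $\boldsymbol{a}$. A (finite) transducer is a tuple $\boldsymbol{t}=(Q,\Sigma,\Gamma,E,I,F)$ where $Q$ is a finite set of states, $I\subseteq Q$ is the nonempty set of initial states, $F\subseteq Q$ is the set of final states, $\Sigma,\Gamma$ are the input and output alphabets, and $E$ is a finite set of transitions. All transducers are assumed to have equal input and output alphabets, $\Sigma=\Gamma$, and to be in standard form: in each transition $(p,x/y,q)\in E$, the input label $x$ is either the empty word $\lambda$ or a symbol of $\Sigma$, and likewise the output label $y$. The label of a path is the pair $(u,v)$, where $u$ (resp. $v$) is the concatenation of the input (resp. output) labels of its transitions. A path is accepting if it starts at an initial state and ends at a final state. For a word $u$, $\boldsymbol{t}(u)$ denotes the set of words $v$ such that $(u,v)$ is the label of some accepting path of $\boldsymbol{t}$. The size $|\boldsymbol{s}|$ of an automaton or transducer $\boldsymbol{s}$ is the sum of the numbers of its states and transitions; polynomial time is w.r.t. the sizes of the inputs. For a transducer $\boldsymbol{t}$ and $k\in\mathbb{N}_0=\{0,1,2,\dots\}$, the class $\mathbb{P}_{\boldsymbol{t},k}$ of languages $L\subseteq\Sigma^*$ is defined by: $L\in\mathbb{P}_{\boldsymbol{t},k}$ iff $|\boldsymbol{t}(u)\cap(L\setminus\{u\})|\le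 k$ for all $u\in L$. *)

(* Defs.v *)
From mathcomp Require Import all_boot all_algebra all_classical.

Set Implicit Arguments.
Unset Strict Implicit.
Unset Printing Implicit Defensive.

Local Open Scope classical_set_scope.
Local Open Scope card_scope.

(** * Automata and transducers *)

(* [label] is the type of transition labels: [S] for an NFA over [S],
   [option S * option S] for a transducer in standard form, where [None] is
   the empty word and [Some x] the one-letter word x. *)
Record machine (label : finType) := Machine {
  state : finType;
  trans : {set state * label * state};
  init : {set state};
  final : {set state}
}.

Definition size_machine (label : finType) (m : machine label) : nat :=
  #|state m| + #|trans m|.

Fixpoint is_path (label : finType) (m : machine label) (p : state m)
    (es : seq (state m * label * state m)) (q : state m) : bool :=
  if es is e :: es' then [&& e \in trans m, e.1.1 == p & is_path e.2 es' q]
  else p == q.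

Definition accepting (label : finType) (m : machine label)
    (es : seq (state m * label * state m)) : Prop :=
  exists p q : state m, [/\ p \in init m, q \in final m & is_path p es q].

Definition nfa (S : finType) := machine S.

Definition lang (S : finType) (a : nfa S) : set (seq S) :=
  [set w | exists2 es, accepting (m := a) es & w = [seq e.1.2 | e <- es]].

Record transducer (S : finType) := Transducer {
  tmachine :> machine (option S * option S)%type;
  init_neq0 : init tmachine != finset.set0
}.

(* [pmap] drops the [None]s, so it concatenates words of length at most 1. *)
Definition tr_image (S : finType) (t : transducer S) (u : seq S) :
    set (seq S) :=
  [set v | exists es, [/\ accepting (m := t) es,
                          u = pmap (fun e => e.1.2.1) es
                        & v = pmap (fun e => e.1.2.2) es]].

Definition inP (S : finType) (t : transducer S) (k : nat) (L : set (seq S)) :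
    Prop :=
  forall u, L u -> (tr_image t u `&` (L `\ u)) #<= `I_k.

(** * Polynomial time

   The model of computation is Jones' language WHILE over binary trees, with
   its usual cost measure (N. D. Jones, Computability and Complexity from a
   Programming Perspective, MIT Press, 1997), which is polynomially equivalent
   to Turing machines.  Atoms are the names of states and alphabet symbols.
   Programs can only copy them and compare two of them for equality, at unit
   cost, so that running times can be measured against the number of states
   and transitions, which does not count the length of names. *)

Inductive tree := Nil | Atom of nat | Cons of tree & tree.

Definition hd (d : tree) : tree := if d is Cons d1 _ then d1 else Nil.
Definition tl (d : tree) : tree := if d is Cons _ d2 then d2 else Nil.

(* [Nil] is false; every other tree is true. *)
Definition truthy (d : tree) : bool := if d is Nil then false else true.

(* Only leaves are compared: the result is false as soon as one argument is a
   [Cons], since comparing whole trees is not a constant-time operation. *)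
Definition eq_leaf (d1 d2 : tree) : tree :=
  match d1, d2 with
  | Nil, Nil => Cons Nil Nil
  | Atom i, Atom j => if i == j then Cons Nil Nil else Nil
  | _, _ => Nil
  end.

Inductive expr :=
  | Var of nat
  | Quote of tree
  | ECons of expr & expr
  | EHd of expr
  | ETl of expr
  | EEq of expr & expr.

Inductive cmd :=
  | Assign of nat & expr
  | Seq of cmd & cmd
  | If of expr & cmd & cmd
  | While of expr & cmd.

Definition store := nat -> tree.

Definition update (s : store) (x : nat) (d : tree) : store :=
  fun y => if y == x then d else s y.

Fixpoint eval (e : expr) (s : store) : tree :=
  match e with
  | Var x => s x
  | Quote d => d
  | ECons e1 e2 => Cons (eval e1 s) (eval e2 s)
  | EHd e1 => hd (eval e1 s)
  | ETl e1 => tl (eval e1 s)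
  | EEq e1 e2 => eq_leaf (eval e1 s) (eval e2 s)
  end.

Fixpoint cost (e : expr) : nat :=
  match e with
  | Var _ | Quote _ => 1
  | ECons e1 e2 | EEq e1 e2 => (cost e1 + cost e2).+1
  | EHd e1 | ETl e1 => (cost e1).+1
  end.

(* [exec c s n s']: started in store [s], the command [c] terminates in store
   [s'] after [n] time units. *)
Inductive exec : cmd -> store -> nat -> store -> Prop :=
  | exec_assign x e s :
      exec (Assign x e) s (cost e).+1 (update s x (eval e s))
  | exec_seq c1 c2 s1 s2 s3 n1 n2 :
      exec c1 s1 n1 s2 -> exec c2 s2 n2 s3 ->
      exec (Seq c1 c2) s1 (n1 + n2).+1 s3
  | exec_if_true e c1 c2 s s' n :
      truthy (eval e s) -> exec c1 s n s' ->
      exec (If e c1 c2) s (cost e + n).+1 s'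
  | exec_if_false e c1 c2 s s' n :
      ~~ truthy (eval e s) -> exec c2 s n s' ->
      exec (If e c1 c2) s (cost e + n).+1 s'
  | exec_while_true e c s1 s2 s3 n1 n2 :
      truthy (eval e s1) -> exec c s1 n1 s2 -> exec (While e c) s2 n2 s3 ->
      exec (While e c) s1 (cost e + n1 + n2).+1 s3
  | exec_while_false e c s :
      ~~ truthy (eval e s) -> exec (While e c) s (cost e).+1 s.

(* The input is given in variable 0, and so is the answer. *)
Definition input_store (d : tree) : store := update (fun=> Nil) 0 d.

Definition poly_time_decidable (I : Type) (size : I -> nat)
    (encode : I -> tree) (P : I -> Prop) : Prop :=
  exists (c : cmd) (p : {poly nat}), forall x : I, exists n s',
    [/\ exec c (input_store (encode x)) n s',
        n <= p.[size x]%R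
      & truthy (s' 0) <-> P x].

(** * Instances and their encoding *)

Definition enc_name (T : finType) (x : T) : tree := Atom (enum_rank x).

Definition enc_seq (T : Type) (f : T -> tree) (s : seq T) : tree :=
  foldr (fun x d => Cons (f x) d) Nil s.

Definition enc_option (T : finType) (x : option T) : tree :=
  if x is Some y then enc_name y else Nil.

Definition enc_io (S : finType) (xy : option S * option S) : tree :=
  Cons (enc_option xy.1) (enc_option xy.2).

Definition enc_trans (Q label : finType) (f : label -> tree)
    (e : Q * label * Q) : tree :=
  Cons (enc_name e.1.1) (Cons (f e.1.2) (enc_name e.2)).

Definition enc_machine (label : finType) (f : label -> tree)
    (m : machine label) : tree :=
  Cons (enc_seq (@enc_name (state m)) (enum (state m)))
    (Cons (enc_seq (enc_trans f) (enum (trans m)))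
      (Cons (enc_seq (@enc_name (state m)) (enum (init m)))
            (enc_seq (@enc_name (state m)) (enum (final m))))).

Record instance := Instance {
  alphabet : finType;
  inst_t : transducer alphabet;
  inst_a : nfa alphabet
}.

(* The alphabet does not count in the size. *)
Definition size_instance (i : instance) : nat :=
  size_machine (inst_t i) + size_machine (inst_a i).

Definition enc_instance (i : instance) : tree :=
  Cons (enc_seq (@enc_name (alphabet i)) (enum (alphabet i)))
    (Cons (enc_machine (@enc_io (alphabet i)) (inst_t i))
          (enc_machine (@enc_name (alphabet i)) (inst_a i))).

(* Main.v *)
(** L(a) is not in P_(t,k) iff k+2 transducers, the identity on L(a) and k+1
    copies of t restricted to L(a), have pairwise distinct outputs on a common
    input.  Let them run synchronously.  For each pair of outputs, the position
    of the first mismatch is the same in both, which is the balance of an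
    integer weight along the run.  A long run splits into a short skeleton that
    visits the same states and simple cycles; grouping these into zero-sum
    blocks, one coordinate at a time, the block of the skeleton is short and
    can be reassembled into a run that still has the mismatches.  So it is
    enough to look for runs of polynomial length, by breadth-first search in the
    polynomially many configurations that consist of the current states and,
    for each ordered pair of outputs, a counter for the position of the
    mismatch and the letter found there. *)

From mathcomp Require Import all_boot all_order all_algebra all_classical zify.
Require Import Defs.

Set Implicit Arguments.
Unset Strict Implicit.
Unset Printing Implicit Defensive.

(** * Polynomial time functions *)

(** A cycle cannot be cut out of a run at will: it may shift the positions of a mismatch in the two
    outputs by different amounts, and distinct outputs may become equal. This is why cycles are
    dropped only in groups that have weight zero for every pair. That the result is still a witness
    has to be seen without looking at the order of the cycles: the transitions carry flags whose
    consistency is a condition on single transitions, so it holds for every walk reassembled from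
    the same annotated transitions. All exponents depend on K = k+2 only: there are 2^(K^2) flag
    functions and K^2 coordinates, and each coordinate roughly squares the bound. This is where k
    has to be fixed. Two features of the programming model matter. Subtrees are copied at unit cost,
    so sizes can double at each step and a time bound does not bound the size of the values. Atoms
    can only be copied and compared, so all counting is done in unary, with lists. *)

Class data (A : Type) := enc : A -> tree.

#[global] Instance data_unit : data unit := fun=> Nil.
(** These are the two values of [eq_leaf], so the result of a comparison is a boolean without
    conversion. *)
#[global] Instance data_bool : data bool := fun b => if b then Cons Nil Nil else Nil.
#[global] Instance data_nat : data nat := Atom.
(** An option is a leaf, as in [enc_option], so that two of them are compared by a single [EEq]. *)
#[global] Instance data_onat : data (option nat) :=
  fun o => if o is Some n then Atom n else Nil.
#[global] Instance data_prod (A B : Type) (dA : data A) (dB : data B) :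
  data (A * B) := fun x => Cons (enc x.1) (enc x.2).
#[global] Instance data_seq (A : Type) (dA : data A) : data (seq A) :=
  enc_seq (@enc A dA).

Fixpoint tsize (d : tree) : nat :=
  if d is Cons d1 d2 then (tsize d1 + tsize d2).+1 else 1.

Definition dsize (A : Type) {dA : data A} (a : A) : nat := tsize (enc a).

Lemma dsize_pair (A B : Type) {dA : data A} {dB : data B} (a : A) (b : B) :
  dsize (a, b) = (dsize a + dsize b).+1.
Proof. by []. Qed.

Lemma dsize_cons (A : Type) {dA : data A} (a : A) (l : seq A) :
  dsize (a :: l) = (dsize a + dsize l).+1.
Proof. by []. Qed.

Lemma dsize_bool (b : bool) : dsize b <= 3.
Proof. by case: b. Qed.

Lemma dsize_onat (o : option nat) : dsize o = 1.
Proof. by case: o. Qed.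

Lemma tsize_gt0 d : 0 < tsize d.
Proof. by case: d. Qed.

(** The base is at least 2, so constants, sums and factors can all be absorbed in the exponent, and
    one number describes the bound. *)
Definition polyb (A : Type) {dA : data A} (g : A -> nat) : Prop :=
  exists e, forall a, g a <= (dsize a).+2 ^ e.

Section Polyb.
Context (A : Type) {dA : data A}.
Implicit Types f g : A -> nat.

Lemma polyb_le f g : (forall a, f a <= g a) -> polyb g -> polyb f.
Proof. by move=> le_fg [e He]; exists e => a; apply: leq_trans (He a). Qed.

Lemma polyb_const n : polyb (fun _ : A => n).
Proof.
exists n => a; apply/ltnW/(leq_trans (ltn_expl n (isT : 1 < 2))).
by case: n => // n; rewrite leq_exp2r.
Qed.

Lemma polyb_dsize : polyb (fun a : A => dsize a).
Proof. by exists 1 => a; rewrite expn1; lia. Qed.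

Lemma polyb_mul f g : polyb f -> polyb g -> polyb (fun a => f a * g a).
Proof.
by move=> [e He] [e' He']; exists (e + e') => a; rewrite expnD leq_mul.
Qed.

Lemma polyb_add f g : polyb f -> polyb g -> polyb (fun a => f a + g a).
Proof.
move=> [e He] [e' He']; exists (e + e').+1 => a.
move: (He a) (He' a); set s := _.+2 => le_f le_g.
have s_gt1 : 1 < s by [].
have le_e : s ^ e <= s ^ (e + e') by rewrite leq_exp2l ?leq_addr.
have le_e' : s ^ e' <= s ^ (e + e') by rewrite leq_exp2l ?leq_addl.
rewrite expnS (leq_trans _ (leq_mul s_gt1 (leqnn _))) // mul2n -addnn.
by apply: leq_add; [apply: leq_trans le_f _ | apply: leq_trans le_g _].
Qed.

Lemma polyb_exp f n : polyb f -> polyb (fun a => f a ^ n).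
Proof.
move=> fb; elim: n => [|n IH]; first exact: polyb_const.
by apply: polyb_le (polyb_mul fb IH) => a; rewrite expnS.
Qed.

Lemma polyb_S f : polyb f -> polyb (fun a => (f a).+1).
Proof.
move=> fb; apply: polyb_le (polyb_add fb (polyb_const 1)) => a.
by rewrite addn1.
Qed.

End Polyb.

Lemma polyb_comp (A B : Type) {dA : data A} {dB : data B} (f : A -> B)
    (g : B -> nat) :
  polyb (fun a => dsize (f a)) -> polyb g -> polyb (fun a => g (f a)).
Proof.
move=> fb [e He]; apply: polyb_le (polyb_exp e (polyb_S (polyb_S fb))).
by move=> a; apply: He.
Qed.

(* For every register [r] there is a copy of the program that works in place in
   [r], uses the registers above [r] as scratch space and leaves those below [r]
   alone: this is what makes programs compose. *)
Definition ptime (A B : Type) {dA : data A} {dB : data B} (f : A -> B) : Prop :=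
  polyb (fun a => dsize (f a)) /\
  exists2 T, polyb T & forall r, exists c, forall s a, s r = enc a ->
    exists n s', [/\ exec c s n s', n <= T a, s' r = enc (f a)
                   & forall y, y < r -> s' y = s y].

Ltac upd := rewrite /update; repeat (case: eqP => ?; try lia).

Section Ptime.
Context (A B C : Type) {dA : data A} {dB : data B} {dC : data C}.

Lemma ptime_ext (f g : A -> B) : f =1 g -> ptime f -> ptime g.
Proof. by move=> /funext ->. Qed.

Lemma ptime_expr (f : A -> B) (ex : nat -> expr) (n : nat) :
    (forall r, cost (ex r) <= n) ->
    (forall r s a, s r = enc a -> eval (ex r) s = enc (f a)) ->
    polyb (fun a => dsize (f a)) -> ptime f.
Proof.
move=> cost_ex eval_ex fb; split=> //; exists (fun=> n.+1).
  exact: polyb_const.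
move=> r; exists (Assign r (ex r)) => s a sr.
exists (cost (ex r)).+1, (update s r (eval (ex r) s)); split.
- exact: exec_assign.
- by rewrite ltnS cost_ex.
- by rewrite /update eqxx; apply: eval_ex.
- by move=> y ltyr; upd.
Qed.

(** The time of [g] is measured on [f a]. Its size is bounded by the first half of [ptime]; the
    running time of [f] alone would allow it to be exponential. *)
Lemma ptime_comp (f : A -> B) (g : B -> C) :
  ptime f -> ptime g -> ptime (fun a => g (f a)).
Proof.
move=> [fb [Tf Tfb Hf]] [gb [Tg Tgb Hg]]; split.
  exact: polyb_comp fb gb.
exists (fun a => (Tf a + Tg (f a)).+1).
  exact/polyb_S/(polyb_add Tfb)/polyb_comp.
move=> r; have [cf {}Hf] := Hf r; have [cg {}Hg] := Hg r.
exists (Seq cf cg) => s a sr.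
have [n1 [s1 [ex1 le1 s1r fr1]]] := Hf s a sr.
have [n2 [s2 [ex2 le2 s2r fr2]]] := Hg s1 (f a) s1r.
exists (n1 + n2).+1, s2; split=> //.
- exact: exec_seq ex1 ex2.
- by rewrite /= ltnS leq_add.
- by move=> y lt_yr; rewrite fr2 ?fr1.
Qed.

(** The argument is first copied to a higher register [q], so that it is still available in [r]
    after the call. *)
Lemma ptime_call (f : A -> B) : ptime f ->
  exists2 T, polyb T & forall r q, r < q -> exists c, forall s a,
    s r = enc a -> exists n s', [/\ exec c s n s', n <= T a,
      s' q = enc (f a) & forall y, y < q -> s' y = s y].
Proof.
move=> [fb [Tf Tfb Hf]]; exists (fun a => (2 + Tf a).+1).
  exact/polyb_S/(polyb_add _ Tfb)/polyb_const.
move=> r q lt_rq; have [c {}Hf] := Hf q.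
exists (Seq (Assign q (Var r)) c) => s a sr.
have [|n [s' [ex le s'q fr]]] := Hf (update s q (s r)) a.
  by rewrite /update eqxx.
exists (2 + n).+1, s'; split=> //.
- by apply: exec_seq ex; apply: exec_assign.
- by move=> y lt_yr; rewrite fr //; upd.
Qed.

End Ptime.

Section PtimeControl.
Context (A B C : Type) {dA : data A} {dB : data B} {dC : data C}.

Lemma ptime_pair (f : A -> B) (g : A -> C) :
  ptime f -> ptime g -> ptime (fun a => (f a, g a)).
Proof.
move=> pf pg; have [fb _] := pf; have [gb _] := pg.
have [Tf Tfb Hf] := ptime_call pf; have [Tg Tgb Hg] := ptime_call pg.
split; first exact/polyb_S/polyb_add.
exists (fun a => (Tf a + (Tg a + 4).+1).+1).
  by apply/polyb_S/(polyb_add Tfb)/polyb_S/(polyb_add Tgb)/polyb_const.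
move=> r; have [cf {}Hf] := Hf r r.+1 (ltnSn r).
have [cg {}Hg] := Hg r r.+2 (ltnW (ltnSn _)).
exists (Seq cf (Seq cg (Assign r (ECons (Var r.+1) (Var r.+2))))) => s a sr.
have [n1 [s1 [ex1 le1 s1r fr1]]] := Hf s a sr.
have [|n2 [s2 [ex2 le2 s2r fr2]]] := Hg s1 a; first by rewrite fr1.
eexists _, _; split.
- apply: (exec_seq ex1); apply: (exec_seq ex2); apply: exec_assign.
- by rewrite /=; lia.
- by rewrite /update eqxx /= s2r fr2 // s1r.
- by move=> y lt_yr; upd; rewrite fr2 ?fr1 //; lia.
Qed.

Lemma ptime_if (b : A -> bool) (f g : A -> B) :
  ptime b -> ptime f -> ptime g -> ptime (fun a => if b a then f a else g a).
Proof.
move=> pb [fb [Tf Tfb Hf]] [gb [Tg Tgb Hg]].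
have [Tb Tbb Hb] := ptime_call pb.
split; first by apply: polyb_le (polyb_add fb gb) => a; case: (b a); lia.
exists (fun a => (Tb a + (1 + (Tf a + Tg a)).+1).+1).
  apply/polyb_S/(polyb_add Tbb)/polyb_S/polyb_add/polyb_add => //.
  exact: polyb_const.
move=> r; have [cb {}Hb] := Hb r r.+1 (ltnSn r).
have [cf {}Hf] := Hf r; have [cg {}Hg] := Hg r.
exists (Seq cb (If (Var r.+1) cf cg)) => s a sr.
have [n1 [s1 [ex1 le1 s1r fr1]]] := Hb s a sr.
have s1a : s1 r = enc a by rewrite fr1.
case ba: (b a) s1r => s1r.
  have [n2 [s2 [ex2 le2 s2r fr2]]] := Hf s1 a s1a.
  exists (n1 + (1 + n2).+1).+1, s2; split=> //.
  - by apply: (exec_seq ex1); apply: exec_if_true ex2; rewrite /= s1r.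
  - by rewrite /=; lia.
  - by move=> y lt_yr; rewrite fr2 ?fr1 // ltnW.
have [n2 [s2 [ex2 le2 s2r fr2]]] := Hg s1 a s1a.
exists (n1 + (1 + n2).+1).+1, s2; split=> //.
- by apply: (exec_seq ex1); apply: exec_if_false ex2; rewrite /= s1r.
- by rewrite /=; lia.
- by move=> y lt_yr; rewrite fr2 ?fr1 // ltnW.
Qed.

End PtimeControl.

Lemma size_le_dsize (A : Type) {dA : data A} (l : seq A) : size l < dsize l.
Proof. by elim: l => //= a l IH; rewrite dsize_cons; lia. Qed.

Lemma dsize_drop (A : Type) {dA : data A} n (l : seq A) :
  dsize (drop n l) <= dsize l.
Proof.
elim: l n => [|a l IH] [|n] //=; rewrite dsize_cons.
by apply: leq_trans (IH n) _; lia.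
Qed.

Section Fold.
Context (X A B : Type) {dX : data X} {dA : data A} {dB : data B}.
Variables (l : X -> seq A) (b0 : X -> B) (f : X -> B -> A -> B).
Hypotheses (pl : ptime l) (pb0 : ptime b0).
Hypothesis pf : ptime (fun y : X * (B * A) => f y.1 y.2.1 y.2.2).
Hypothesis fb : exists2 M, polyb M &
  forall x n, dsize (foldl (f x) (b0 x) (take n (l x))) <= M x.

(** Iterating a polynomial time step can make the accumulator grow exponentially; the hypothesis
    [fb] bounds all its intermediate values in advance. Register [r] holds [x], the next two hold
    the rest of the list and the accumulator, and the step is run in [r.+3]. *)
Lemma ptime_foldl : ptime (fun x => foldl (f x) (b0 x) (l x)).
Proof.
have [M Mb HM] := fb; have [lb _] := pl; have [b0b _] := pb0.
have [fsb [Tf [e He] Hf]] := pf.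
have [Tl Tlb Hl] := ptime_call pl; have [Tb Tbb Hb] := ptime_call pb0.
split.
  by apply: polyb_le Mb => x; have := HM x (size (l x)); rewrite take_size.
(* The step is applied to [(x, (b, a))]: two successors come from the two pairings, two from the
   base in [polyb]. The constant 20 covers the assignments and the loop test. *)
pose (Tstep := fun x => (dsize x + (M x + dsize (l x))).+4 ^ e + 20).
have Tstepb : polyb Tstep.
  apply: polyb_add; last exact: polyb_const.
  apply: polyb_exp; do 4 apply: polyb_S.
  by apply: polyb_add (polyb_add Mb lb); exact: polyb_dsize.
exists (fun x => Tl x + Tb x + (size (l x) * Tstep x + 20)).
  apply: polyb_add (polyb_add Tlb Tbb) _; apply: polyb_add _ (polyb_const 20).
  apply: polyb_mul Tstepb; apply: polyb_le lb => x.
  exact/ltnW/size_le_dsize.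
move=> r; have [cl {}Hl] := Hl r r.+1 (ltnSn r).
have [cb {}Hb] := Hb r r.+2 (ltnW (ltnSn _)).
have [cf {}Hf] := Hf r.+3.
pose body := Seq (Assign r.+3 (ECons (Var r) (ECons (Var r.+2) (EHd (Var r.+1)))))
  (Seq cf (Seq (Assign r.+2 (Var r.+3)) (Assign r.+1 (ETl (Var r.+1))))).
exists (Seq cl (Seq cb (Seq (While (Var r.+1) body) (Assign r (Var r.+2))))).
move=> s x sr.
have [n1 [s1 [ex1 le1 s1r fr1]]] := Hl s x sr.
have [|n2 [s2 [ex2 le2 s2r fr2]]] := Hb s1 x; first by rewrite fr1.
(* Loop invariant, with [m] the number of iterations that remain; the 2 in the time bound is the
   last, failing test. *)
have loop m t : m <= size (l x) -> t r = enc x ->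
    t r.+1 = enc (drop (size (l x) - m) (l x)) ->
    t r.+2 = enc (foldl (f x) (b0 x) (take (size (l x) - m) (l x))) ->
  exists n t', [/\ exec (While (Var r.+1) body) t n t', n <= m * Tstep x + 2,
    t' r.+2 = enc (foldl (f x) (b0 x) (l x)) & forall y, y < r -> t' y = t y].
  elim: m t => [|m IH] t le_m tr tr1 tr2.
    exists 2, t; split=> //; last by rewrite tr2 subn0 take_size.
    by apply: exec_while_false; rewrite /= tr1 subn0 drop_size.
  set i := size (l x) - m.+1 in tr1 tr2.
  have lt_i : i < size (l x) by rewrite /i; lia.
  have Si : size (l x) - m = i.+1 by rewrite /i; lia.
  have [a0 _] : exists a : A, True by case: (l x) lt_i => // a *; exists a.
  have Edrop := drop_nth a0 lt_i; have Etake := take_nth a0 lt_i.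
  set a := nth a0 (l x) i in Edrop Etake.
  set b := foldl _ _ _ in tr2.
  pose t1 := update t r.+3 (Cons (t r) (Cons (t r.+2) (hd (t r.+1)))).
  have [|n3 [t2 [ex3 le3 t2r fr3]]] := Hf t1 (x, (b, a)).
    by rewrite /t1 /update eqxx tr tr2 tr1 Edrop.
  pose t3 := update t2 r.+2 (t2 r.+3).
  pose t4 := update t3 r.+1 (tl (t3 r.+1)).
  have frt y : y <= r.+1 -> t2 y = t y.
    by move=> le_y; rewrite fr3; [rewrite /t1; upd | lia].
  have frt4 y : y <= r -> t4 y = t y.
    by move=> le_y; rewrite /t4 /t3; upd; rewrite frt //; lia.
  have [|||n4 [t5 [ex4 le4 t5r fr4]]] := IH t4 (ltnW le_m).
  - by rewrite frt4.
  - by rewrite /t4 {1}/update eqxx /t3; upd; rewrite frt // tr1 Edrop Si.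
  - by rewrite /t4 /t3; upd; rewrite t2r Si Etake foldl_rcons.
  eexists _, t5; split; [| | exact: t5r |].
  - apply: exec_while_true ex4; first by rewrite /= tr1 Edrop.
    apply: exec_seq; first exact: exec_assign.
    apply: exec_seq; first exact: ex3.
    by apply: exec_seq; exact: exec_assign.
  - have leTf : Tf (x, (b, a)) <= (dsize x + (M x + dsize (l x))).+4 ^ e.
      apply: leq_trans (He _) _; case: (e) => // e'; rewrite leq_exp2r //.
      rewrite !dsize_pair.
      have : dsize b <= M x by apply: HM.
      have := @dsize_drop _ dA i (l x); rewrite Edrop dsize_cons; lia.
    by rewrite /= mulSn /Tstep; rewrite /Tstep in le4; lia.
  - by move=> y lt_yr; rewrite fr4 // frt4 // ltnW.
have [||||n3 [s3 [ex3 le3 s3r fr3]]] := loop (size (l x)) s2.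
- by [].
- by rewrite fr2 ?fr1.
- by rewrite fr2 // s1r subnn drop0.
- by rewrite s2r subnn take0.
eexists _, _; split.
- apply: (exec_seq ex1); apply: (exec_seq ex2); apply: (exec_seq ex3).
  exact: exec_assign.
- by rewrite /=; lia.
- by rewrite /update eqxx.
- move=> y lt_yr; upd; rewrite fr3 // fr2 ?fr1 //; lia.
Qed.

End Fold.

(** * Operations on lists *)

Section Basic.
Context {X A B C : Type} {dX : data X} {dA : data A} {dB : data B}.
Implicit Types (f : X -> A) (g : X -> B).

(** A function that changes the type but not the encoding needs no code at all. Examples are [Some]
    on numbers and the passage from a pair to a [cons]. *)
Lemma ptime_recast (h : A -> B) f :
  (forall a, enc (h a) = enc a) -> ptime f -> ptime (fun x => h (f x)).
Proof.
move=> eh [fb [T Tb Hf]]; split.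
  by apply: polyb_le fb => x; rewrite /dsize eh.
exists T => // r; have [c {}Hf] := Hf r; exists c => s x /Hf [n [s' [? ? s'r ?]]].
by exists n, s'; split; rewrite ?eh.
Qed.

Lemma ptime_id : ptime (fun x : X => x).
Proof.
by apply: (ptime_expr (ex := Var) (n := 1)) => //; apply: polyb_dsize.
Qed.

Lemma ptime_const (a : A) : ptime (fun _ : X => a).
Proof.
apply: (ptime_expr (ex := fun=> Quote (enc a)) (n := 1)) => //.
exact: polyb_const.
Qed.

Lemma ptime_fst (f : X -> A * B) : ptime f -> ptime (fun x => (f x).1).
Proof.
move=> pf; apply: (ptime_comp pf).
apply: (ptime_expr (ex := fun r => EHd (Var r)) (n := 2)) => //.
  by move=> r s a /= ->.
(apply: polyb_le; last exact: polyb_dsize) => -[a b].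
by rewrite dsize_pair /=; lia.
Qed.

Lemma ptime_snd (f : X -> A * B) : ptime f -> ptime (fun x => (f x).2).
Proof.
move=> pf; apply: (ptime_comp pf).
apply: (ptime_expr (ex := fun r => ETl (Var r)) (n := 2)) => //.
  by move=> r s a /= ->.
(apply: polyb_le; last exact: polyb_dsize) => -[a b].
by rewrite dsize_pair /=; lia.
Qed.

End Basic.

Section Operations.
Context {X A : Type} {dX : data X} {dA : data A}.
Implicit Types (b : X -> bool) (o : X -> option nat) (l : X -> seq A).

Lemma ptime_cons (f : X -> A) l :
  ptime f -> ptime l -> ptime (fun x => f x :: l x).
Proof.
move=> pf pl; apply: (ptime_comp (ptime_pair pf pl) (g := fun y => y.1 :: y.2)).
exact: (ptime_recast (h := fun y => y.1 :: y.2) _ ptime_id).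
Qed.

Lemma ptime_behead l : ptime l -> ptime (fun x => behead (l x)).
Proof.
move=> pl; apply: (ptime_comp pl).
apply: (ptime_expr (ex := fun r => ETl (Var r)) (n := 2)) => //.
  by move=> r s [|a t] /= ->.
(apply: polyb_le; last exact: polyb_dsize) => -[|a t] //=; rewrite dsize_cons; lia.
Qed.

Lemma ptime_nilp l : ptime l -> ptime (fun x => nilp (l x)).
Proof.
move=> pl; apply: (ptime_comp pl).
apply: (ptime_expr (ex := fun r => EEq (Var r) (Quote Nil)) (n := 3)) => //.
  by move=> r s [|a t] /= ->.
by (apply: polyb_le; last exact: (polyb_const 3)) => t; apply: dsize_bool.
Qed.

Lemma ptime_head (x0 : A) l : ptime l -> ptime (fun x => head x0 (l x)).
Proof.
move=> pl; apply: (ptime_comp pl); split.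
  (apply: polyb_le; last by
    apply: polyb_add; [exact: polyb_dsize | exact: (polyb_const (dsize x0))]) => -[|a t].
    exact: leq_addl.
  by rewrite dsize_cons /=; lia.
exists (fun=> 20); first exact: polyb_const.
move=> r.
exists (If (Var r) (Assign r (EHd (Var r))) (Assign r (Quote (enc x0)))).
move=> s [|a t] sr; eexists _, _; split.
- by apply: exec_if_false; [rewrite /= sr | exact: exec_assign].
- by [].
- by rewrite /update eqxx.
- by move=> y ltyr; upd.
- by apply: exec_if_true; [rewrite /= sr | exact: exec_assign].
- by [].
- by rewrite /update eqxx /= sr.
- by move=> y ltyr; upd.
Qed.

Lemma ptime_eqn (m n : X -> nat) :
  ptime m -> ptime n -> ptime (fun x => m x == n x).
Proof.
move=> pm pn; apply: (ptime_comp (ptime_pair pm pn) (g := fun y => y.1 == y.2)).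
apply: (ptime_expr (ex := fun r => EEq (EHd (Var r)) (ETl (Var r))) (n := 5)) => //.
  by move=> r s [i j] /= -> /=; case: eqP.
by (apply: polyb_le; last exact: (polyb_const 3)) => y; apply: dsize_bool.
Qed.

Lemma ptime_eqo o o' : ptime o -> ptime o' -> ptime (fun x => o x == o' x).
Proof.
move=> po po'; apply: (ptime_comp (ptime_pair po po') (g := fun y => y.1 == y.2)).
apply: (ptime_expr (ex := fun r => EEq (EHd (Var r)) (ETl (Var r))) (n := 5)) => //.
  move=> r s [[i|] [j|]] /= -> /=; rewrite ?eqxx //.
by (apply: polyb_le; last exact: (polyb_const 3)) => y; apply: dsize_bool.
Qed.

Lemma ptime_Some (n : X -> nat) : ptime n -> ptime (fun x => Some (n x)).
Proof. exact: ptime_recast. Qed.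

Lemma ptime_negb b : ptime b -> ptime (fun x => ~~ b x).
Proof. by move=> pb; apply: (ptime_if pb); apply: ptime_const. Qed.

Lemma ptime_andb b b' : ptime b -> ptime b' -> ptime (fun x => b x && b' x).
Proof. by move=> pb pb'; apply: (ptime_if pb) => //; apply: ptime_const. Qed.

End Operations.

Ltac pt1 := cbv beta; first [assumption | lazymatch goal with
  | |- @ptime _ _ _ _ (fun x => x) => apply ptime_id
  | |- @ptime _ _ _ _ fst => apply ptime_fst; apply ptime_id
  | |- @ptime _ _ _ _ snd => apply ptime_snd; apply ptime_id
  | |- @ptime _ _ _ _ (fun x => (@?f x).1) => apply (@ptime_fst _ _ _ _ _ _ f)
  | |- @ptime _ _ _ _ (fun x => (@?f x).2) => apply (@ptime_snd _ _ _ _ _ _ f)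
  | |- @ptime _ _ _ _ (fun x => (@?f x, @?g x)) =>
    apply (@ptime_pair _ _ _ _ _ _ f g)
  | |- @ptime _ _ _ _ (fun x => ~~ @?b x) => apply (@ptime_negb _ _ b)
  | |- @ptime _ _ _ _ (fun x => @?b x && @?c x) => apply (@ptime_andb _ _ b c)
  | |- @ptime _ _ _ _ (fun x => @?f x :: @?l x) =>
    apply (@ptime_cons _ _ _ _ f l)
  | |- @ptime _ _ _ _ (fun x => behead (@?l x)) =>
    apply (@ptime_behead _ _ _ _ l)
  | |- @ptime _ _ _ _ (fun x => head ?x0 (@?l x)) =>
    apply (@ptime_head _ _ _ _ x0 l)
  | |- @ptime _ _ _ _ (fun x => nilp (@?l x)) => apply (@ptime_nilp _ _ _ _ l)
  | |- @ptime _ _ _ _ (fun x => Some (@?f x)) => apply (@ptime_Some _ _ f)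
  | |- @ptime _ _ _ _ (fun x => @eq_op _ (@?f x) (@?g x)) =>
    first [apply (@ptime_eqn _ _ f g) | apply (@ptime_eqo _ _ f g)]
  | |- @ptime _ _ _ _ (fun x => if _ then _ else _) => apply ptime_if
  | |- _ => apply ptime_const
  end].
Ltac pt := repeat pt1.

Section ListSize.
Context {A B : Type} {dA : data A} {dB : data B}.
Implicit Types l : seq A.

Lemma dsize_cat l1 l2 : (dsize (l1 ++ l2)).+1 = dsize l1 + dsize l2.
Proof. by elim: l1 => //= a l1 IH; rewrite !dsize_cons; lia. Qed.

Lemma dsize_take n l : dsize (take n l) <= dsize l.
Proof.
have := dsize_cat (take n l) (drop n l); rewrite cat_take_drop.
have : 0 < dsize (drop n l) by apply: tsize_gt0.
lia.
Qed.

Lemma dsize_rev l : dsize (rev l) = dsize l.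
Proof.
elim: l => // a l IH; rewrite rev_cons -cats1.
have := dsize_cat (rev l) [:: a]; rewrite !dsize_cons IH.
have -> : dsize ([::] : seq A) = 1 by []; lia.
Qed.

Lemma dsize_map (f : A -> B) l m M :
  (forall a, dsize a <= m -> dsize (f a) <= M) -> dsize l <= m ->
  dsize (map f l) <= size l * M.+1 + 1.
Proof.
move=> fM; elim: l => //= a l IH; rewrite !dsize_cons => le_m.
have := IH _; have := fM a _; move: le_m; lia.
Qed.

Lemma dsize_filter (p : pred A) l : dsize (seq.filter p l) <= dsize l.
Proof.
elim: l => //= a l IH; case: ifP => _; rewrite !dsize_cons; lia.
Qed.

Lemma dsize_flatten (ll : seq (seq A)) : dsize (flatten ll) <= dsize ll.
Proof.
elim: ll => //= l ll IH; rewrite dsize_cons.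
have := dsize_cat l (flatten ll); lia.
Qed.

End ListSize.

Lemma ptime_rev (X A : Type) {dX : data X} {dA : data A} (l : X -> seq A) :
  ptime l -> ptime (fun x => rev (l x)).
Proof.
move=> pl; have [lb _] := pl.
have revE s : rev s = foldl (fun t (a : A) => a :: t) [::] s.
  by rewrite -[s in RHS]revK foldl_rev; elim: (rev s) => //= a t <-.
apply: (ptime_ext (f := fun x => foldl (fun t a => a :: t) [::] (l x))).
  by move=> x; rewrite revE.
apply: (ptime_foldl (b0 := fun=> [::]) (f := fun=> fun t a => a :: t)) => //.
- by pt.
- by pt.
- exists (fun x => dsize (l x)) => // x n.
  by rewrite -revE dsize_rev dsize_take.
Qed.

Section Foldr.
Context {X A B : Type} {dX : data X} {dA : data A} {dB : data B}.
Variables (l : X -> seq A) (b0 : X -> B) (f : X -> A -> B -> B).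

Lemma ptime_foldr :
  ptime l -> ptime b0 -> ptime (fun y : X * (B * A) => f y.1 y.2.2 y.2.1) ->
  (exists2 M, polyb M &
    forall x n, dsize (foldr (f x) (b0 x) (drop n (l x))) <= M x) ->
  ptime (fun x => foldr (f x) (b0 x) (l x)).
Proof.
move=> pl pb pf [M Mb HM].
apply: (ptime_ext
  (f := fun x => foldl (fun b a => f x a b) (b0 x) (rev (l x)))).
  by move=> x; rewrite foldl_rev.
apply: (@ptime_foldl _ _ _ _ _ _ _ _ (fun x b a => f x a b)) => //.
  exact: ptime_rev.
by exists M => // x n; rewrite take_rev foldl_rev.
Qed.

End Foldr.

Lemma ptime_app2 (X A B Z : Type) {dX : data X} {dA : data A} {dB : data B}
    {dZ : data Z} (p : X -> A -> B) (g : Z -> X) (h : Z -> A) :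
  ptime (fun y : X * A => p y.1 y.2) -> ptime g -> ptime h ->
  ptime (fun z => p (g z) (h z)).
Proof. by move=> pp pg ph; apply: (ptime_comp (ptime_pair pg ph) pp). Qed.

Section Lists.
Context {X A B : Type} {dX : data X} {dA : data A} {dB : data B}.
Variable l : X -> seq A.
Hypothesis pl : ptime l.

Lemma ptime_has (p : X -> A -> bool) :
  ptime (fun y : X * A => p y.1 y.2) -> ptime (fun x => has (p x) (l x)).
Proof.
move=> pp.
apply: (ptime_ext (f := fun x => foldr (fun a b => p x a || b) false (l x))).
  by move=> x; elim: (l x) => //= a s ->.
apply: (ptime_foldr (f := fun x a b => p x a || b)) => //; first by pt.
  apply: ptime_if; [| by pt | by pt].
  by apply: (ptime_app2 pp); pt.
exists (fun=> 3); [exact: polyb_const | by move=> *; apply: dsize_bool].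
Qed.

Lemma ptime_map (f : X -> A -> B) :
  ptime (fun y : X * A => f y.1 y.2) -> ptime (fun x => map (f x) (l x)).
Proof.
move=> pf; have [[e He] _] := pf; have [lb _] := pl.
apply: (ptime_foldr (f := fun x a b => f x a :: b)) => //; first by pt.
  by apply: ptime_cons; [apply: (ptime_app2 pf) |]; pt.
pose (M := fun x => (dsize x + dsize (l x)).+3 ^ e).
exists (fun x => dsize (l x) * (M x).+1 + 1).
  apply: polyb_add; last exact: polyb_const.
  apply: polyb_mul => //; apply/polyb_S/polyb_exp; do 3 apply: polyb_S.
  by apply: polyb_add => //; apply: polyb_dsize.
move=> x n; rewrite -/(map _ _).
have fM a : dsize a <= dsize (l x) -> dsize (f x a) <= M x.
  move=> le_a; apply: leq_trans (He (x, a)) _.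
  by rewrite /M; case: (e) => // e'; rewrite leq_exp2r // dsize_pair; lia.
apply: leq_trans (dsize_map fM (dsize_drop _ _)) _.
rewrite leq_add2r leq_mul2r; apply/orP; right.
apply: ltnW; apply: leq_trans (dsize_drop n _); exact: size_le_dsize.
Qed.

Lemma ptime_filter (p : X -> A -> bool) :
  ptime (fun y : X * A => p y.1 y.2) -> ptime (fun x => seq.filter (p x) (l x)).
Proof.
move=> pp; have [lb _] := pl.
apply: (ptime_ext
  (f := fun x => foldr (fun a s => if p x a then a :: s else s) [::] (l x))).
  by move=> x; elim: (l x) => //= a s ->.
apply: (ptime_foldr (f := fun x a s => if p x a then a :: s else s)) => //.
- by pt.
- by apply: ptime_if; [apply: (ptime_app2 pp) | |]; pt.
exists (fun x => dsize (l x)) => // x n.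
have -> s : foldr (fun a s => if p x a then a :: s else s) [::] s = seq.filter (p x) s.
  by elim: s => //= a s ->.
exact: leq_trans (dsize_filter _ _) (dsize_drop _ _).
Qed.

Lemma ptime_cat (l' : X -> seq A) : ptime l' -> ptime (fun x => l x ++ l' x).
Proof.
move=> pl'; have [lb _] := pl; have [lb' _] := pl'.
have catE (s s' : seq A) : s ++ s' = foldr cons s' s by elim: s => //= a s ->.
apply: (ptime_ext (f := fun x => foldr cons (l' x) (l x))).
  by move=> x; rewrite catE.
apply: (ptime_foldr (f := fun=> cons)) => //; first by pt.
exists (fun x => dsize (l x) + dsize (l' x)); first exact: polyb_add.
move=> x n; rewrite -catE.
have := @dsize_drop _ dA n (l x); have := @dsize_cat _ dA (drop n (l x)) (l' x); lia.
Qed.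

End Lists.

Lemma ptime_flatten (X A : Type) {dX : data X} {dA : data A} (l : X -> seq (seq A)) :
  ptime l -> ptime (fun x => flatten (l x)).
Proof.
move=> pl; have [lb _] := pl.
apply: (ptime_foldr (f := fun=> cat)) => //; first by pt.
  by apply: ptime_cat; pt.
exists (fun x => dsize (l x)) => // x n.
exact: leq_trans (dsize_flatten _) (dsize_drop _ _).
Qed.

Lemma ptime_allpairs (X A B C : Type) {dX : data X} {dA : data A}
    {dB : data B} {dC : data C} (l : X -> seq A) (l' : X -> A -> seq B)
    (f : X -> A -> B -> C) :
  ptime l -> ptime (fun y : X * A => l' y.1 y.2) ->
  ptime (fun y : X * A * B => f y.1.1 y.1.2 y.2) ->
  ptime (fun x => [seq f x a b | a <- l x, b <- l' x a]).
Proof.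
move=> pl pl' pf.
apply: ptime_flatten.
apply: (ptime_map pl (f := fun x a => [seq f x a b | b <- l' x a])).
exact: (ptime_map pl' (f := fun y b => f y.1 y.2 b)).
Qed.

(** * Short balanced walks *)

Lemma count_lt (T : eqType) (p q : pred T) (s : seq T) a :
  subpred p q -> a \in s -> q a -> ~~ p a -> count p s < count q s.
Proof.
move=> pq a_in qa pa; have pr := perm_to_rem a_in.
rewrite (permP pr p) (permP pr q) /= qa (negbTE pa) add0n add1n ltnS.
exact: sub_count.
Qed.

(** * Decomposition of a walk into a skeleton and short cycles *)

Section Walk.
Variables (V A : eqType) (src tgt : A -> V).
Implicit Types (x y z v : V) (p q c : seq A).

Fixpoint walk x p y : bool :=
  if p is a :: p' then (src a == x) && walk (tgt a) p' y else x == y.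

Definition visits x p : seq V := x :: map tgt p.

Lemma walk_cat x p q z :
  walk x (p ++ q) z = walk x p (last x (map tgt p)) && walk (last x (map tgt p)) q z.
Proof. by elim: p x => [|a p IH] x /=; rewrite ?eqxx // IH andbA. Qed.

Lemma walk_last x p y : walk x p y -> last x (map tgt p) = y.
Proof. by elim: p x => [|a p IH] x /= => [/eqP | /andP[_ /IH]]. Qed.

Lemma walk_trans x p y q z : walk x p y -> walk y q z -> walk x (p ++ q) z.
Proof. by move=> wp wq; rewrite walk_cat (walk_last wp) wp. Qed.

Lemma walk_split x p y v : walk x p y -> v \in visits x p ->
  exists p1 p2, [/\ p = p1 ++ p2, walk x p1 v & walk v p2 y].
Proof.
elim: p x => [|a p IH] x /=.
  by move=> xy; rewrite inE => /eqP ->; exists [::], [::]; rewrite /= eqxx.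
move=> /andP[ax wp]; rewrite inE => /predU1P[-> | v_in].
  by exists [::], (a :: p); rewrite /= eqxx ax.
have [p1 [p2 [-> w1 w2]]] := IH _ wp v_in.
by exists (a :: p1), p2; rewrite /= ax.
Qed.

(** Loop erasure, starting from the end: if [x] already lies on the simple walk obtained for the
    rest, the part of that walk up to [x] closes to a cycle, which is short because the walk is
    simple. Edges are only tracked up to permutation, since weights do not depend on their order. *)
Lemma simple_walk (VS : seq V) x p y :
    walk x p y -> {subset visits x p <= VS} ->
  exists p0 cs, [/\ walk x p0 y, uniq (visits x p0), perm_eq p (p0 ++ flatten cs)
    & forall c, c \in cs -> size c <= size VS /\
        exists2 v, v \in visits x p & walk v c v].
Proof.
elim: p x => [|a p IH] x /=; first by exists [::], [::].
move=> /andP[ax wp] sVS.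
have [|p0 [cs [w0 u0 pp csP]]] := IH _ wp.
  by move=> v v_in; apply: sVS; rewrite inE v_in orbT.
have s0 : {subset visits (tgt a) p0 <= visits (tgt a) p}.
  move=> v; rewrite !inE => /orP[-> //|v_in]; apply/orP; right.
  by rewrite (perm_mem (perm_map tgt pp)) map_cat mem_cat v_in.
have csP' c : c \in cs -> size c <= size VS /\
    exists2 v, v \in x :: tgt a :: map tgt p & walk v c v.
  by move=> /csP[le_c [v v_in wv]]; split=> //; exists v; rewrite // inE v_in orbT.
case: (boolP (x \in visits (tgt a) p0)) => [x_in | x_notin]; last first.
  by exists (a :: p0), cs; split; rewrite /= ?ax ?w0 ?perm_cons //= x_notin.
have [p1 [p2 [Ep w1 w2]]] := walk_split w0 x_in.
exists p2, ((a :: p1) :: cs); split=> //.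
- move: u0; rewrite Ep /visits map_cat -cat_cons lastI cat_rcons cat_uniq.
  by rewrite (walk_last w1) => /and3P[].
- apply/permP => P; have := permP pp P; rewrite Ep /= !count_cat /= ?count_cat.
  by clear; lia.
- move=> c; rewrite inE => /predU1P[-> | /csP' //]; split.
    rewrite /= (leq_trans _ (uniq_leq_size u0 _)) //.
      by rewrite Ep /= size_map size_cat leq_addr.
    by move=> v /s0 v_in; apply: sVS; rewrite inE v_in orbT.
  by exists x; rewrite ?mem_head //= ax.
Qed.

(** Loop erasure may remove the vertices at which the cycles are based, and then the cycles cannot
    be put back. So the walk is cut at each first visit to a vertex outside [S], the vertices seen
    so far, and loops are erased within the segments only. There are at most as many cuts as
    vertices of [VS] outside [S], which gives the second factor of the bound. *)
Lemma skeleton_walk (VS S : seq V) x p y :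
    walk x p y -> {subset visits x p <= VS} -> x \in S ->
  exists p0 cs, [/\ walk x p0 y, perm_eq p (p0 ++ flatten cs),
      size p0 <= (size VS).+1 * (count (fun v => v \notin S) VS).+1
    & forall c, c \in cs -> size c <= size VS /\
        exists2 v, v \in S ++ map tgt p0 & walk v c v].
Proof.
elim: {p}(size p) {-2}p (leqnn (size p)) x S => [|n IH] p.
  rewrite leqn0 => /nilP -> x S /= xy _ x_in.
  by exists [::], [::]; rewrite /= xy.
move=> le_p x S wp sVS xS.
case: (boolP (all (fun a => tgt a \in S) p)) => [inS | /allPn].
  have [p0 [cs [w0 u0 pp csP]]] := simple_walk wp sVS.
  exists p0, cs; split=> //.
    have/= := uniq_leq_size u0 (s2 := VS).
    rewrite size_map => lep; apply: leq_trans (leq_pmulr _ _) => //.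
    apply/ltnW/ltnW/lep => v; rewrite inE => /predU1P[->|].
      by apply: sVS; apply: mem_head.
    move=> v_in; apply: sVS; rewrite inE (perm_mem (perm_map tgt pp)) map_cat.
    by rewrite mem_cat v_in orbT.
  move=> c /csP[le_c [v v_in wv]]; split=> //; exists v => //.
  rewrite mem_cat; apply/orP; left; move: v_in; rewrite inE => /predU1P[-> //|].
  by case/mapP=> a /(allP inS) ? ->.
move=> ex_a.
have {}ex_a : has (fun a => tgt a \notin S) p by apply/hasP.
(* The edge [a] is the first one that leads outside [S]. The segment [p1] stays in [S], hence so do
   the base points of its cycles; [a] itself is kept in the skeleton. *)
case/split_find: ex_a wp sVS le_p => a p1 p2 aS p1S.
rewrite cat_rcons walk_cat /= => /and3P[w1 ax w2] sVS le_p.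
have [|p10 [cs1 [w10 u10 pp1 csP1]]] := simple_walk (VS := VS) w1.
  move=> v v_in; apply: sVS; rewrite /visits map_cat -cat_cons mem_cat.
  by rewrite -/(visits x p1) v_in.
have [|||p20 [cs2 [w20 pp2 le20 csP2]]] := IH p2 _ (tgt a) (tgt a :: S) w2.
- by move: le_p; rewrite size_cat /=; clear; lia.
- move=> v v_in; apply: sVS; rewrite /visits map_cat -cat_cons mem_cat /=.
  by rewrite -/(visits (tgt a) p2) v_in orbT.
- exact: mem_head.
have inS v : v \in visits x p1 -> v \in S.
  rewrite inE => /predU1P[-> //|/mapP[b b_in ->]].
  by move/hasPn: p1S => /(_ _ b_in); rewrite negbK.
exists (p10 ++ a :: p20), (cs1 ++ cs2); split.
- by apply: (walk_trans w10); rewrite /= ax.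
- apply/permP => P; have := permP pp1 P; have := permP pp2 P.
  by rewrite flatten_cat !count_cat /= ?count_cat; clear; lia.
- have lt_c : count (fun v => v \notin tgt a :: S) VS < count (fun v => v \notin S) VS.
    apply: (count_lt (a := tgt a)); rewrite ?mem_head //.
      by move=> v; rewrite inE negb_or => /andP[].
    by apply: sVS; rewrite inE map_cat mem_cat /= mem_head !orbT.
  have/= := uniq_leq_size u10 (s2 := VS); rewrite size_map size_cat /= => lep.
  have {}lep : size p10 < size VS.
    apply: lep => v; rewrite inE => /predU1P[->|].
      by apply: sVS; apply: mem_head.
    move=> v_in; apply: sVS; rewrite inE map_cat mem_cat (perm_mem (perm_map tgt pp1)).
    by rewrite map_cat mem_cat v_in orbT.
  by move: lt_c lep le20; clear; nia.
- move=> c; rewrite mem_cat => /orP[/csP1[le_c [v /inS v_in wv]] | ].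
    by split=> //; exists v; rewrite // mem_cat v_in.
  move=> /csP2[le_c [v v_in wv]]; split=> //; exists v => //.
  move: v_in; rewrite map_cat /= !mem_cat !inE.
  by rewrite mem_cat => /or3P[] ->; rewrite ?orbT.
Qed.

Lemma attach_cycles x p0 y cs :
    walk x p0 y ->
    (forall c, c \in cs -> exists2 v, v \in visits x p0 & walk v c v) ->
  exists2 p, walk x p y & perm_eq p (p0 ++ flatten cs).
Proof.
move=> w0; elim: cs => [|c cs IH] csP; first by exists p0; rewrite ?cats0.
have [|p wp pp] := IH; first by move=> c' c'_in; apply: csP; rewrite inE c'_in orbT.
have [v v_in wv] := csP c (mem_head _ _).
have [|p1 [p2 [Ep w1 w2]]] := walk_split wp (v := v).
  move: v_in; rewrite /visits !inE => /orP[-> //|v_in]; apply/orP; right.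
  by rewrite (perm_mem (perm_map tgt pp)) map_cat mem_cat v_in.
exists (p1 ++ c ++ p2); first exact: walk_trans w1 (walk_trans wv w2).
apply/permP => P; have := permP pp P; rewrite Ep /= !count_cat; lia.
Qed.

End Walk.

(** * Partition of a zero-sum list into short zero-sum blocks *)

Section ZeroSum.
Local Open Scope ring_scope.
Import Order.TTheory GRing.Theory Num.Theory.

Definition total (T : Type) (w : T -> int) (s : seq T) : int :=
  \sum_(t <- s) w t.

Section Total.
Variables (T : eqType) (w : T -> int).
Implicit Types s : seq T.

Lemma total_nil : total w [::] = 0.
Proof. exact: big_nil. Qed.

Lemma total_cons t s : total w (t :: s) = w t + total w s.
Proof. exact: big_cons. Qed.

Lemma total_cat s1 s2 : total w (s1 ++ s2) = total w s1 + total w s2.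
Proof. exact: big_cat. Qed.

Lemma total_perm s1 s2 : perm_eq s1 s2 -> total w s1 = total w s2.
Proof. exact: perm_big. Qed.

Lemma total_flatten (ss : seq (seq T)) : total w (flatten ss) = total (total w) ss.
Proof. exact: big_flatten. Qed.

Lemma totalN s : total (fun t => - w t) s = - total w s.
Proof. exact: sumrN. Qed.

End Total.

Lemma ex_ge0_sum (T : eqType) (w : T -> int) (L : seq T) :
  L != [::] -> 0 <= total w L -> exists2 t, t \in L & 0 <= w t.
Proof.
move=> L0 sum_ge0; apply/hasP; apply: contraT => /hasPn neg.
suff: total w L < 0 by rewrite ltNge sum_ge0.
case: L L0 neg {sum_ge0} => // t L _ neg; rewrite total_cons.
have : w t < 0 by have /= := neg t (mem_head _ _); rewrite -ltNge.
suff : total w L <= 0 by lia.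
rewrite /total big_seq; apply: sumr_le0 => u u_in.
by have /= := neg u; rewrite inE u_in orbT -ltNge => /(_ isT)/ltW.
Qed.

Lemma size_bounded_ints (M : nat) (s : seq int) :
  uniq s -> (forall z, z \in s -> - M%:Z <= z <= M%:Z) -> (size s <= M.*2.+1)%N.
Proof.
move=> us sM; pose r := [seq i%:Z - M%:Z | i <- iota 0 M.*2.+1].
have -> : M.*2.+1 = size r by rewrite size_map size_iota.
apply: uniq_leq_size => // z /sM zM; apply/mapP.
by exists (absz (z + M%:Z)); [rewrite mem_iota | ]; lia.
Qed.

Section Block.
Variables (T : eqType) (w : T -> int) (M : nat) (L : seq T).
Hypothesis wM : forall t, t \in L -> - M%:Z <= w t <= M%:Z.
Hypothesis sumL : total w L = 0.

(* Items are picked greedily, with a sign opposite to that of the current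
   prefix sum, so that prefix sums stay in [-M, M] until one is repeated. *)
Lemma zero_sum_block : L != [::] ->
  exists b L', [/\ perm_eq L (b ++ L'), b != [::], (size b <= M.*2.+1)%N
    & total w b = 0].
Proof.
move=> L0.
pose S (pre : seq T) := [seq total w (take i pre) | i <- iota 0 (size pre).+1].
(* The prefix sums of [pre], the empty one included, are distinct integers in [-M, M]. There are at
   most 2M+1 of these, so the selection stops before [pre] has 2M+1 items. *)
suff main n pre rest : (M.*2.+1 - size pre <= n)%N -> perm_eq L (pre ++ rest) ->
    uniq (S pre) -> (forall z, z \in S pre -> - M%:Z <= z <= M%:Z) ->
    exists b L', [/\ perm_eq L (b ++ L'), b != [::], (size b <= M.*2.+1)%N
    & total w b = 0].
  apply: (main _ [::] L (leqnn _)) => //= z.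
  by rewrite inE total_nil => /eqP ->; lia.
elim: n pre rest => [|n IH] pre rest le_n pL uS SM.
  by have := size_bounded_ints uS SM; rewrite size_map size_iota; lia.
have le_S := size_bounded_ints uS SM; rewrite size_map size_iota in le_S.
set s := total w pre.
have s_in : s \in S pre.
  by apply/mapP; exists (size pre); rewrite ?take_size ?mem_iota //=.
have sum_rest : total w rest = - s.
  by move: sumL; rewrite (total_perm _ pL) total_cat -/s /=; lia.
(* If all items had been picked, the sum of [pre] would be zero, which is already the sum of the
   empty prefix. *)
have rest0 : rest != [::].
  apply: contraTneq uS => rest0.
  have s0 : s = 0 by move: sum_rest; rewrite rest0 total_nil; lia.
  have pre0 : (0 < size pre)%N.
    rewrite lt0n size_eq0; apply: contraNneq L0 => pre0.
    by rewrite -size_eq0 (perm_size pL) pre0 rest0.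
  rewrite /S /= take0 total_nil negb_and negbK; apply/orP; left.
  apply/mapP; exists (size pre); last by rewrite take_size.
  by rewrite mem_iota; lia.
have [t t_in t_sign] : exists2 t, t \in rest & - M%:Z <= s + w t <= M%:Z.
  have wMr t : t \in rest -> - M%:Z <= w t <= M%:Z.
    by move=> t_in; apply: wM; rewrite (perm_mem pL) mem_cat t_in orbT.
  have sM := SM _ s_in.
  case: (lerP s 0) => s0.
    have [|t t_in t0] := ex_ge0_sum (w := w) rest0; first by rewrite sum_rest; lia.
    by exists t => //; have := wMr t t_in; lia.
  have [|t t_in t0] := ex_ge0_sum (w := fun t => - w t) rest0.
    by rewrite totalN sum_rest; lia.
  by exists t => //; have := wMr t t_in; lia.
have pL' : perm_eq L ((rcons pre t) ++ rem t rest).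
  rewrite cat_rcons; apply: perm_trans pL _; rewrite perm_cat2l.
  exact: perm_to_rem.
have S_rcons : S (rcons pre t) = rcons (S pre) (s + w t).
  rewrite /S size_rcons -[(_.+2)]addn1 iotaD map_cat cats1 /=; congr (rcons (_ :: _) _).
    by rewrite !take0.
    apply/eq_in_map => i; rewrite mem_iota => /andP[_ lt_i].
    by rewrite -cats1 takel_cat //; lia.
  by rewrite take_oversize ?size_rcons // -cats1 total_cat /= total_cons total_nil addr0.
case: (boolP (s + w t \in S pre)) => [/mapP[i] | notin]; last first.
  apply: (IH (rcons pre t) (rem t rest)) => //.
  - by rewrite size_rcons; lia.
  - by rewrite S_rcons rcons_uniq notin.
  - by move=> z; rewrite S_rcons mem_rcons inE => /predU1P[-> //|/SM].
rewrite mem_iota => /andP[_ lt_i] sum_i.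
(* The items between two equal prefix sums add up to zero. *)
exists (rcons (drop i pre) t), (take i pre ++ rem t rest); split.
- apply/permP => P; have := permP pL' P.
  by rewrite -{1}(cat_take_drop i pre) -!cats1 !count_cat; lia.
- by rewrite -size_eq0 size_rcons.
- by rewrite size_rcons size_drop; lia.
rewrite -cats1 total_cat total_cons total_nil addr0 /=.
have := sum_i; rewrite /s -{1}(cat_take_drop i pre) total_cat /=; lia.
Qed.

End Block.

Lemma zero_sum_blocks (T : eqType) (w : T -> int) (M : nat) (L : seq T) :
    (forall t, t \in L -> - M%:Z <= w t <= M%:Z) -> total w L = 0 ->
  exists2 Ls, perm_eq L (flatten Ls) & forall b, b \in Ls ->
    (size b <= M.*2.+1)%N /\ total w b = 0.
Proof.
elim: {L}(size L) {-2}L (leqnn (size L)) => [|n IH] L.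
  by rewrite leqn0 => /nilP -> _ _; exists [::].
move=> le_n wM sumL; case: (eqVneq L [::]) => [-> | L0]; first by exists [::].
have [b [L' [pL b0 le_b sum_b]]] := zero_sum_block wM sumL L0.
have [|||Ls pLs LsP] := IH L'.
- by move: le_n b0; rewrite (perm_size pL) size_cat -size_eq0; lia.
- by move=> t t_in; apply: wM; rewrite (perm_mem pL) mem_cat t_in orbT.
- by move: sumL; rewrite (total_perm _ pL) total_cat sum_b /= add0r.
exists (b :: Ls); first by rewrite (perm_trans pL) //= perm_cat2l.
by move=> b'; rewrite inE => /predU1P[-> | /LsP].
Qed.

(** If blocks balanced in [m'] coordinates have at most B items, their weight in the next coordinate
    is at most B * M in absolute value, so at most 2 * B * M + 1 of them are merged. For fixed [m]
    this is a polynomial in [M] of degree 2^m - 1. *)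
Fixpoint block_bound (M m : nat) : nat :=
  if m is m'.+1 then block_bound M m' * (block_bound M m' * M).*2.+1 else 1.

(* One coordinate at a time: the blocks that are balanced for the first ones
   are the items for the next one. *)
Lemma zero_sum_multi_blocks (J T : eqType) (w : J -> T -> int) (M : nat)
    (js : seq J) (L : seq T) :
    (forall j t, t \in L -> - M%:Z <= w j t <= M%:Z) ->
    (forall j, j \in js -> total (w j) L = 0) ->
  exists2 Ls, perm_eq L (flatten Ls) & forall b, b \in Ls ->
    (size b <= block_bound M (size js))%N /\
    forall j, j \in js -> total (w j) b = 0.
Proof.
move=> wM; elim: js => [|j0 js IH] sumL.
  exists [seq [:: t] | t <- L]; first by elim: L {wM sumL} => //= t L; rewrite perm_cons.
  by move=> b /mapP[t _ ->].
have [|Ls pL LsP] := IH.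
  by move=> j j_in; apply: sumL; rewrite inE j_in orbT.
set B := block_bound M (size js) in LsP.
have [||Gs pG GsP] := zero_sum_blocks (w := total (w j0))
  (M := B * M) (L := Ls).
- move=> b b_in; have [le_b _] := LsP b b_in.
  have {}wM t : t \in b -> - M%:Z <= w j0 t <= M%:Z.
    move=> t_in; apply: wM; rewrite (perm_mem pL); apply/flattenP.
    by exists b.
  have : - (size b * M)%N%:Z <= total (w j0) b <= (size b * M)%N%:Z.
    elim: b wM {b_in le_b} => [|t b IHb] wM; first by rewrite total_nil; lia.
    have := wM t (mem_head _ _); rewrite total_cons /= mulSn.
    have := IHb (fun u u_in => wM u (mem_behead (s := t :: b) u_in)); lia.
  have : (size b * M <= B * M)%N by rewrite leq_mul.
  lia.
- rewrite -total_flatten -(total_perm _ pL).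
  by apply: sumL; apply: mem_head.
exists (map flatten Gs).
  apply: perm_trans pL _; apply/permP => P.
  rewrite !count_flatten -map_comp (perm_sumn (perm_map _ pG)).
  by elim: (Gs) => //= G Gs' IHG; rewrite map_cat sumn_cat IHG count_flatten.
move=> b /mapP[G G_in ->]; have [le_G sum_G] := GsP G G_in.
have GLs b' : b' \in G -> b' \in Ls.
  by move=> b'_in; rewrite (perm_mem pG); apply/flattenP; exists G.
split.
  rewrite /= -/B; apply: leq_trans (leq_mul (leqnn B) le_G).
  elim: G GLs {G_in le_G sum_G} => //= b' G IHG GLs.
  rewrite size_cat mulnS leq_add //; last first.
    by apply: IHG => c c_in; apply: GLs; rewrite inE c_in orbT.
  by have [] := LsP b' (GLs _ (mem_head _ _)).
move=> j; rewrite inE total_flatten =>  /predU1P[-> // | j_in].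
rewrite /total big_seq big1 // => b' /GLs /LsP[_]; exact.
Qed.

End ZeroSum.

(** * Shortening a balanced walk *)

Lemma count_le_flatten (T : eqType) (P : pred T) (b : seq T) (bs : seq (seq T)) :
  b \in bs -> count P b <= count P (flatten bs).
Proof.
elim: bs => //= c bs IH; rewrite inE count_cat => /predU1P[-> | /IH].
  exact: leq_addr.
by move=> le_b; apply: leq_trans le_b (leq_addl _ _).
Qed.

Lemma size_flatten_le (T : eqType) (M : nat) (ss : seq (seq T)) :
  (forall s, s \in ss -> size s <= M) -> size (flatten ss) <= size ss * M.
Proof.
elim: ss => //= s ss IH sM; rewrite size_cat mulSn leq_add ?sM ?mem_head //.
by apply: IH => t t_in; apply: sM; rewrite inE t_in orbT.
Qed.

(** With [N] vertices, (N+1)^2 bounds the length of the skeleton and of every cycle, and therefore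
    also their weights, as an edge weighs at most 1. The result is the number of items in a block
    times the length of an item. *)
Definition pump_bound (N m : nat) : nat :=
  block_bound (N.+1 * N.+1) m * (N.+1 * N.+1).

Section Pump.
Local Open Scope ring_scope.
Import Order.TTheory GRing.Theory Num.Theory.
Variables (V A J : eqType) (src tgt : A -> V) (w : J -> A -> int) (js : seq J).

Lemma total_bound (T : eqType) (u : T -> int) (p : seq T) :
  {in p, forall a, -1 <= u a <= 1} -> - (size p)%:Z <= total u p <= (size p)%:Z.
Proof.
elim: p => [|a p IH] up; first by rewrite total_nil.
have := up a (mem_head _ _); rewrite total_cons /=.
have := IH (fun b b_in => up b (mem_behead (s := a :: p) b_in)); lia.
Qed.

Lemma short_balanced_walk (VS : seq V) x p y :
    walk src tgt x p y -> {subset visits tgt x p <= VS} ->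
    (forall j, {in p, forall a, -1 <= w j a <= 1}) ->
    (forall j, j \in js -> total (w j) p = 0) ->
  exists p', [/\ walk src tgt x p' y, {subset p' <= p},
    forall j, j \in js -> total (w j) p' = 0
    & (size p' <= pump_bound (size VS) (size js))%N].
Proof.
move=> wp sVS w1 sum_p.
have [p0 [cs [w0 pp le_p0 csP]]] := skeleton_walk wp sVS (mem_head x [::]).
set N := size VS in le_p0 csP *; pose M := (N.+1 * N.+1)%N.
have le_M c : c \in p0 :: cs -> (size c <= M)%N.
  rewrite inE => /predU1P[-> | /csP[le_c _]]; last by rewrite /M; nia.
  by apply: leq_trans le_p0 _; rewrite leq_mul // ltnS count_size.
have in_p c : c \in p0 :: cs -> {subset c <= p}.
  move=> c_in a a_in; rewrite (perm_mem pp).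
  by have : a \in flatten (p0 :: cs) by apply/flattenP; exists c.
(* The skeleton is an item like the cycles: its own weight has to be compensated by some of them. *)
have [||Ls pL LsP] := zero_sum_multi_blocks (w := fun j => total (w j)) (M := M)
  (js := js) (L := p0 :: cs).
- move=> j c c_in; have := le_M c c_in.
  have := @total_bound _ (w j) c (fun a a_in => w1 j a (in_p c c_in a a_in)); lia.
- move=> j j_in; rewrite -(sum_p j j_in) -total_flatten.
  by apply/total_perm; rewrite perm_sym.
have /flattenP[b b_in p0_b] : p0 \in flatten Ls.
  by rewrite -(perm_mem pL) mem_head.
have [le_b sum_b] := LsP b b_in.
have pb := perm_to_rem p0_b; set b' := rem p0 b in pb.
(* Membership alone would not do, since [p0] can be equal to one of the cycles; multiplicities are
   compared instead. *)
have b'cs : {subset b' <= cs}.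
  move=> c; rewrite -!has_pred1 !has_count => c_b'.
  have := count_le_flatten (pred1 c) b_in.
  by rewrite -(permP pL) (permP pb) /= leq_add2l; apply: leq_trans.
have [|p' w' pp'] := attach_cycles (cs := b') w0.
  by move=> c /b'cs /csP[_]; rewrite cat1s.
have pp'' : perm_eq p' (flatten (p0 :: b')) by [].
have b_L c : c \in p0 :: b' -> c \in p0 :: cs.
  by rewrite !inE => /predU1P[->|/b'cs ->]; rewrite ?eqxx ?orbT.
exists p'; split=> //.
- move=> a; rewrite (perm_mem pp'') => /flattenP[c /b_L /in_p]; exact.
- by move=> j j_in; rewrite (total_perm _ pp'') total_flatten -(total_perm _ pb) sum_b.
- rewrite (perm_size pp''); apply: leq_trans (size_flatten_le (M := M) _) _.
    by move=> c /b_L /le_M.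
  by rewrite -(perm_size pb) leq_mul2r le_b orbT.
Qed.

End Pump.

(** * Pairwise distinct outputs *)

Section Mismatch.
Variable S : eqType.
Implicit Types s t : seq S.

(* The end of a sequence counts as a letter. *)
Fixpoint mismatch s t : nat :=
  match s, t with
  | x :: s', y :: t' => if x == y then (mismatch s' t').+1 else 0
  | _, _ => 0
  end.

Lemma mismatchC s t : mismatch s t = mismatch t s.
Proof. by elim: s t => [|x s IH] [|y t] //=; rewrite eq_sym IH. Qed.

Lemma mismatch_le s t : mismatch s t <= size s.
Proof. by elim: s t => [|x s IH] [|y t] //=; case: ifP => // _; apply: IH. Qed.

Lemma onth_mismatch s t :
  s <> t -> onth s (mismatch s t) <> onth t (mismatch s t).
Proof.
elim: s t => [|x s IH] [|y t] //=; case: eqP => [<- | ne] ne_st /=.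
  by apply: IH => Est; apply: ne_st; rewrite Est.
by case.
Qed.

Lemma onth_oversize s n : size s <= n -> onth s n = None.
Proof. by move=> le_n; rewrite onthE nth_default ?size_map. Qed.

End Mismatch.

Section Distinct.
Variables (V G S : eqType) (src tgt : G -> V) (K : nat).
Variable out : 'I_K -> G -> option S.
Implicit Types (x y : V) (gs : seq G) (i j : 'I_K).

Definition word i gs : seq S := pmap (out i) gs.

(* A transition is annotated with the sets of pairs [(i, j)] such that the
   output [i] is already longer than its first mismatch with the output [j],
   before and after the transition.  On the annotated paths, the outputs [i] and
   [j] have their mismatch at the same position iff the weight of [(i, j)]
   is balanced. *)
Local Notation flags := {ffun 'I_K * 'I_K -> bool}.
Local Notation aedge := (flags * G * flags)%type.

Let asrc (a : aedge) : flags * V := (a.1.1, src a.1.2).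
Let atgt (a : aedge) : flags * V := (a.2, tgt a.1.2).

(** A letter is counted when the flag is still off after it, that is, when it comes strictly before
    the mismatch. The number of counted letters is thus the position of the mismatch. *)
Let counted i j : pred aedge := fun a => isSome (out i a.1.2) && ~~ a.2 (i, j).

Local Open Scope ring_scope.
Let weight (ij : 'I_K * 'I_K) (a : aedge) : int :=
  (counted ij.1 ij.2 a)%:Z - (counted ij.2 ij.1 a)%:Z.

Lemma total_weight ij (p : seq aedge) : total (weight ij) p =
  (count (counted ij.1 ij.2) p)%:Z - (count (counted ij.2 ij.1) p)%:Z.
Proof.
elim: p => [|a p IH]; first by rewrite total_nil.
by rewrite total_cons IH /weight /=; lia.
Qed.
Local Close Scope ring_scope.

Lemma walk_forget f x (p : seq aedge) f' y :
  walk asrc atgt (f, x) p (f', y) -> walk src tgt x [seq a.1.2 | a <- p] y.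
Proof.
elim: p f x => [|a p IH] f x /=; first by move/eqP=> [_ ->].
by move=> /andP[/eqP[_ ->] /IH ->]; rewrite eqxx.
Qed.

Section Paths.
Variable c : 'I_K -> 'I_K -> option S.

(** A flag is never switched off, and it is switched on only by a transition that outputs the
    prescribed letter [c i j]. As this concerns single transitions, it is inherited by any walk made
    of transitions of the annotated run. *)
Let flips (a : aedge) := forall i j, (a.1.1 (i, j) -> a.2 (i, j)) /\
  (~~ a.1.1 (i, j) -> a.2 (i, j) -> isSome (out i a.1.2) /\ out i a.1.2 = c i j).

Lemma flagged_count i j f x (p : seq aedge) f' y : walk asrc atgt (f, x) p (f', y) ->
  (forall a, a \in p -> flips a) -> f (i, j) ->
  count (counted i j) p = 0 /\ f' (i, j).
Proof.
elim: p f x => [|a p IH] f x /=; first by move=> /eqP[-> _].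
move=> /andP[/eqP[Ef _] wp] fl f_ij.
have a_ij : a.2 (i, j) by apply: (fl a (mem_head _ _) i j).1; rewrite Ef.
have [|-> f'_ij] := IH _ _ wp _ a_ij.
  by move=> b b_in; apply: fl; rewrite inE b_in orbT.
by rewrite /counted a_ij andbF.
Qed.

(** Exactly one transition switches the flag on, and its letter is [c i j]. If none does, all
    letters of the output are counted and the position is just past its end. *)
Lemma unflagged_onth i j f x (p : seq aedge) f' y :
  walk asrc atgt (f, x) p (f', y) -> (forall a, a \in p -> flips a) -> ~~ f (i, j) ->
  onth (word i [seq a.1.2 | a <- p]) (count (counted i j) p) =
  if f' (i, j) then c i j else None.
Proof.
elim: p f x => [|a p IH] f x /=.
  by move=> /eqP[-> _] _ /negbTE ->.
move=> /andP[/eqP[Ef _] wp] fl f_ij.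
have fl' b : b \in p -> flips b by move=> b_in; apply: fl; rewrite inE b_in orbT.
case a_ij: (a.2 (i, j)).
  have [-> ->] := flagged_count wp fl' a_ij.
  have [] := (fl a (mem_head _ _) i j).2 _ a_ij; first by rewrite Ef.
  rewrite /counted a_ij andbF /word /=.
  by case: (out i _).
rewrite -(IH _ _ wp fl') ?a_ij // /counted a_ij andbT /word /=.
by case: (out i _).
Qed.

End Paths.

Section Annotate.
Variable l : 'I_K -> 'I_K -> nat.

(** Here [n i] is the number of letters that output [i] has so far, and [l i j] is the position to
    be reached. *)
Definition flag (n : 'I_K -> nat) : flags := [ffun ij => l ij.1 ij.2 < n ij.1].

Fixpoint annotate (n : 'I_K -> nat) gs : seq aedge :=
  if gs is g :: gs' then
    let n' := fun i => n i + isSome (out i g) in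
    (flag n, g, flag n') :: annotate n' gs'
  else [::].

Lemma annotate_edges n gs : [seq a.1.2 | a <- annotate n gs] = gs.
Proof. by elim: gs n => //= g gs IH n; rewrite IH. Qed.

Lemma size_word_cons i g gs :
  size (word i (g :: gs)) = isSome (out i g) + size (word i gs).
Proof. by rewrite /word /=; case: (out i g). Qed.

Lemma walk_annotate n x gs y : walk src tgt x gs y ->
  walk asrc atgt (flag n, x) (annotate n gs)
    (flag (fun i => n i + size (word i gs)), y).
Proof.
elim: gs n x => [|g gs IH] n x /=.
  move/eqP->; rewrite (_ : (fun i => n i + _) = n) //.
  by apply/funext => i; rewrite addn0.
move=> /andP[/eqP <- /(IH (fun i => n i + isSome (out i g)))].
rewrite /asrc eqxx /=; congr (walk _ _ _ _ (flag _, _)); apply/funext => i.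
by rewrite size_word_cons addnA.
Qed.

Lemma count_annotate i j n gs : count (counted i j) (annotate n gs) =
  minn (l i j - n i) (size (word i gs)).
Proof.
elim: gs n => [|g gs IH] n /=; first by rewrite minn0.
rewrite IH size_word_cons /counted ffunE /=.
by case: (out i g) => [b|] /=; lia.
Qed.

Lemma annotate_flag n gs a : a \in annotate n gs ->
  exists2 f, a.1.1 = flag f & forall i, n i <= f i.
Proof.
elim: gs n => //= g gs IH n; rewrite inE => /predU1P[-> /= | /IH[f Ef le_f]].
  by exists n.
by exists f => // i; apply: leq_trans (le_f i); apply: leq_addr.
Qed.

Lemma flips_annotate i j n gs a : a \in annotate n gs ->
  (a.1.1 (i, j) -> a.2 (i, j)) /\
  (~~ a.1.1 (i, j) -> a.2 (i, j) -> isSome (out i a.1.2) /\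
     out i a.1.2 = onth (word i gs) (l i j - n i)).
Proof.
elim: gs n => //= g gs IH n; rewrite inE => /predU1P[-> /= | a_in].
  rewrite !ffunE /=; split; first by lia.
  case Eo: (out i g) => [b|] /=; last by lia.
  rewrite /word /= ?Eo /= => le1 le2; split=> //.
  by have -> : l i j - n i = 0 by lia.
have [mono flip] := IH _ a_in; split=> // na ya.
have [ya' Eo] := flip na ya; split=> //; rewrite {}Eo.
have lt_n : n i + isSome (out i g) <= l i j.
  have [f Ef le_f] := annotate_flag a_in.
  by move: na (le_f i); rewrite Ef ffunE /=; lia.
rewrite /word /=; case: (out i g) lt_n => [b|] /= lt_n; last by rewrite addn0.
by have -> : l i j - n i = (l i j - (n i + 1)).+1 by lia.
Qed.

End Annotate.

(** The mismatch positions and the letters found there are those of the given run. Shortening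
    preserves the end point of the annotated walk, hence the final flags, and the balance. So the
    new outputs [i] and [j] have these same two letters at a common position, though it may be a
    different one. The vertices are pairs of a flag function and a vertex of [VS], and there is one
    coordinate for each of the K^2 pairs. *)
Lemma short_distinct_walk (VS : seq V) x gs y :
    walk src tgt x gs y -> {subset visits tgt x gs <= VS} ->
    (forall i j, i != j -> word i gs <> word j gs) ->
  exists gs', [/\ walk src tgt x gs' y, {subset gs' <= gs},
      forall i j, i != j -> word i gs' <> word j gs'
    & size gs' <= pump_bound (2 ^ (K * K) * size VS) (K * K)].
Proof.
move=> wgs sVS dist.
pose l i j := mismatch (word i gs) (word j gs).
have lC i j : l i j = l j i by apply: mismatchC.
pose p := annotate l (fun=> 0) gs.
pose AVS := [seq (f, v) | f <- enum {: flags}, v <- VS].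
pose js := enum {: 'I_K * 'I_K}.
have wp := walk_annotate l (fun=> 0) wgs; rewrite -/p in wp.
have flp a : a \in p -> forall i j, (a.1.1 (i, j) -> a.2 (i, j)) /\
    (~~ a.1.1 (i, j) -> a.2 (i, j) ->
     isSome (out i a.1.2) /\ out i a.1.2 = onth (word i gs) (l i j)).
  by move=> a_in i j; have := flips_annotate i j a_in; rewrite subn0.
have [|||p' [wp' sp' sum_p' le_p']] := @short_balanced_walk _ _ _ asrc atgt
    weight js AVS _ _ _ wp.
- move=> [f v] fv_in; apply/allpairsP; exists (f, v); split=> //=.
    by rewrite mem_enum.
  have : (f, v).2 \in map snd (visits atgt (flag l (fun=> 0), x) p) by apply: map_f.
  rewrite /visits /= -map_comp => {}fv_in; apply: sVS; rewrite /visits.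
  rewrite -(annotate_edges l (fun=> 0) gs) -map_comp -/p; move: fv_in.
  by congr (_ \in _ :: _); apply: eq_map.
- move=> ij a _; rewrite /weight; case: (counted _ _ _); case: (counted _ _ _) => //.
- move=> [i j] _; rewrite total_weight /= /p !count_annotate !subn0 (lC j i).
  have le_i : l i j <= size (word i gs) by apply: mismatch_le.
  have le_j : l i j <= size (word j gs) by rewrite lC; apply: mismatch_le.
  lia.
pose gs' := [seq a.1.2 | a <- p'].
have wgs' : walk src tgt x gs' y by apply: walk_forget wp'.
have onth_gs' i j : onth (word i gs') (count (counted i j) p') =
    onth (word i gs) (l i j).
  rewrite (unflagged_onth (c := fun i j => onth (word i gs) (l i j)) (i := i) (j := j) wp').
  (* A final flag that is off means that the mismatch is the end of the original output, where
     [onth] gives [None]. *)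
  - rewrite ffunE /= add0n; case: ltnP => // le_l; rewrite onth_oversize //.
  - by move=> a /sp' /flp.
  - by rewrite ffunE.
exists gs'; split=> //.
- move=> g /mapP[a /sp' a_in ->]; rewrite -(annotate_edges l (fun=> 0) gs).
  exact: map_f.
- move=> i j ne_ij Ew; have := onth_mismatch (dist i j ne_ij).
  rewrite -/(l i j) {2}lC -!onth_gs' Ew; apply; congr onth.
  have := sum_p' (i, j); rewrite mem_enum total_weight /= => /(_ isT); lia.
- rewrite size_map; apply: leq_trans le_p' _.
  rewrite /js /AVS size_allpairs -!cardE card_prod card_ord.
  by rewrite card_ffun card_prod card_ord card_bool.
Qed.

End Distinct.

(** * Search for a synchronous run *)

Fixpoint pow (T : Type) (n : nat) (l : seq T) : seq (seq T) :=
  if n is n'.+1 then [seq x :: s | x <- l, s <- pow n' l] else [:: [::]].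

Lemma mem_pow (T : eqType) n (l s : seq T) :
  (s \in pow n l) = (size s == n) && all (mem l) s.
Proof.
elim: n s => [|n IH] [|x s] //=.
  by apply/negbTE/negP => /allpairsP[[y t] []].
rewrite eqSS andbCA -IH; apply/allpairsP/andP => [[[y t] [/= y_in t_in [-> ->]]] //|].
by move=> [x_in s_in]; exists (x, s).
Qed.

Lemma size_pow (T : Type) n (l : seq T) : size (pow n l) = size l ^ n.
Proof. by elim: n => //= n IH; rewrite size_allpairs IH expnS. Qed.

(** Applied to a unary number, this enumerates the unary numbers up to it; programs cannot do
    arithmetic on atoms. *)
Fixpoint suffixes (T : Type) (l : seq T) : seq (seq T) :=
  if l is _ :: l' then l :: suffixes l' else [:: [::]].

Lemma mem_suffixes (l n : seq unit) : (n \in suffixes l) = (size n <= size l).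
Proof.
have unitE (s : seq unit) : s = nseq (size s) tt by elim: s => //= -[] s <-.
elim: l => [|[] l IH] /=; first by rewrite inE leqn0 size_eq0.
rewrite inE IH [in RHS]leq_eqVlt ltnS; congr (_ || _).
by apply/eqP/eqP => [->|En] //; rewrite (unitE n) (unitE l) En.
Qed.

Notation onat := (option nat).
Notation xstate := (nat * nat)%type.
Notation xedge := (xstate * ((onat * onat) * xstate))%type.
(* States, transitions, initial states and final states. *)
Notation xducer := (seq xstate * (seq xedge * (seq xstate * seq xstate)))%type.
(* A letter to be observed on a tape: the number of letters that remain before
   it, in unary, and the letter once it has been seen. *)
Notation register := (seq unit * onat)%type.
Notation tape := (xstate * seq register)%type.

Definition xsrc (e : xedge) : xstate := e.1.
Definition xin (e : xedge) : onat := e.2.1.1.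
Definition xout (e : xedge) : onat := e.2.1.2.
Definition xtgt (e : xedge) : xstate := e.2.2.

Definition edge0 : xedge := ((0, 0), ((None, None), (0, 0))).
Definition register0 : register := ([::], None).
Definition tape0 : tape := ((0, 0), [::]).
Definition xducer0 : xducer := ([::], ([::], ([::], [::]))).

Definition emit (y : onat) (r : register) : register :=
  if y == None then r
  else if nilp r.1 then ([::], if r.2 == None then y else r.2)
  else (behead r.1, r.2).

Definition emits (r : register) (ys : seq onat) : register :=
  foldl (fun r y => emit y r) r ys.

Lemma emits_onth (n : seq unit) ys :
  (emits (n, None) ys).2 = onth (pmap id ys) (size n).
Proof.
have doneE b zs : (emits ([::], Some b) zs).2 = Some b.
  by elim: zs => //= -[z|].
elim: ys n => [|[y|] ys IH] [|u n] //=;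
  (exact: doneE || exact: IH [::] || exact: IH n || exact: IH (u :: n)).
Qed.

Section Search.
Variables (K : nat) (clock : seq unit) (Ts : seq xducer).

Definition states : seq xstate := flatten [seq T.1 | T <- Ts].
Definition edges_of (i : nat) : seq xedge := (nth xducer0 Ts i).2.1.
Definition init_of (i : nat) : seq xstate := (nth xducer0 Ts i).2.2.1.
Definition final_of (i : nat) : seq xstate := (nth xducer0 Ts i).2.2.2.
(** Labels are collected from the transitions, because the alphabet does not count in the size of an
    instance. *)
Definition inputs : seq onat := flatten [seq [seq xin e | e <- T.2.1] | T <- Ts].
Definition outputs : seq onat := flatten [seq [seq xout e | e <- T.2.1] | T <- Ts].

Definition registers : seq register :=
  [seq (n, y) | n <- suffixes clock, y <- None :: outputs].

Definition tapes : seq tape :=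
  [seq (q, rs) | q <- states, rs <- pow K registers].

Definition configs : seq (seq tape) := pow K tapes.

Definition tape_of (c : seq tape) (i : nat) : tape := nth tape0 c i.
Definition reg (c : seq tape) (i j : nat) : register :=
  nth register0 (tape_of c i).2 j.

Definition tape_step (x : onat) (d d' : tape) (e : xedge) : bool :=
  [&& xin e == x, xsrc e == d.1, xtgt e == d'.1
    & [seq emit (xout e) r | r <- d.2] == d'.2].

Definition step (c c' : seq tape) : bool :=
  has (fun x => all (fun i =>
    has (tape_step x (tape_of c i) (tape_of c' i)) (edges_of i)) (iota 0 K))
  inputs.

(** The counters of [(i, j)] and [(j, i)] start with the same value, which is a guess of a position
    where the two outputs differ. Any such position will do, first or not. *)
Definition is_init (c : seq tape) : bool :=
  all (fun i => has (fun q => q == (tape_of c i).1) (init_of i) &&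
    all (fun j => ((reg c i j).1 == (reg c j i).1) && ((reg c i j).2 == None))
      (iota 0 K)) (iota 0 K).

Definition is_final (c : seq tape) : bool :=
  all (fun i => has (fun q => q == (tape_of c i).1) (final_of i) &&
    all (fun j => (i == j) || ((reg c i j).2 != (reg c j i).2))
      (iota 0 K)) (iota 0 K).

(** Selecting from the fixed list [configs], instead of generating successors, keeps every level of
    the search no larger than that list. *)
Definition next (cs : seq (seq tape)) : seq (seq tape) :=
  [seq c' <- configs | has (fun c => step c c') cs].

(** Only runs with exactly as many steps as the clock has entries are found; shorter ones are
    prolonged by stuttering. *)
Definition search : bool :=
  has is_final (foldl (fun cs _ => next cs) [seq c <- configs | is_init c] clock).

(* A transition of the synchronous product of the [K] transducers. *)
Definition sync (g : seq xedge) : Prop :=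
  [/\ size g = K, forall i, i < K -> nth edge0 g i \in edges_of i
    & exists x, forall i, i < K -> xin (nth edge0 g i) = x].

Definition gsrc (g : seq xedge) : seq xstate := [seq xsrc e | e <- g].
Definition gtgt (g : seq xedge) : seq xstate := [seq xtgt e | e <- g].

Definition outs (i : nat) (gs : seq (seq xedge)) : seq onat :=
  [seq xout (nth edge0 g i) | g <- gs].
Definition outw (i : nat) (gs : seq (seq xedge)) : seq nat :=
  pmap (fun g => xout (nth edge0 g i)) gs.

Lemma pmap_outs i gs : pmap id (outs i gs) = outw i gs.
Proof. by elim: gs => //= g gs ->. Qed.

Definition sync_run (xs : seq xstate) (gs : seq (seq xedge)) (ys : seq xstate) :=
  [/\ walk gsrc gtgt xs gs ys, {in gs, forall g, sync g}, size xs = K,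
      forall i, i < K -> nth (0, 0) xs i \in init_of i
    & forall i, i < K -> nth (0, 0) ys i \in final_of i].

Definition advance (c : seq tape) (g : seq xedge) : seq tape :=
  mkseq (fun i => (xtgt (nth edge0 g i),
    [seq emit (xout (nth edge0 g i)) r | r <- (tape_of c i).2])) K.

Definition states_of (c : seq tape) : seq xstate := [seq d.1 | d <- c].

Hypothesis sizeTs : size Ts = K.
Hypothesis edges_wf : forall i e, i < K -> e \in edges_of i ->
  (e.1 \in states) && (xtgt e \in states).
Hypothesis init_wf : forall i q, i < K -> q \in init_of i -> q \in states.
Hypothesis K_gt0 : 0 < K.

Lemma mem_inputs i e : i < K -> e \in edges_of i -> xin e \in inputs.
Proof.
move=> lt_i e_in; apply/flattenP; exists [seq xin e | e <- edges_of i].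
  by apply/mapP; exists (nth xducer0 Ts i); rewrite ?mem_nth ?sizeTs.
exact: map_f.
Qed.

Lemma mem_outputs i e : i < K -> e \in edges_of i -> xout e \in outputs.
Proof.
move=> lt_i e_in; apply/flattenP; exists [seq xout e | e <- edges_of i].
  by apply/mapP; exists (nth xducer0 Ts i); rewrite ?mem_nth ?sizeTs.
exact: map_f.
Qed.

Lemma size_advance c g : size (advance c g) = K.
Proof. by rewrite size_mkseq. Qed.

Lemma tape_advance c g i : i < K -> tape_of (advance c g) i =
  (xtgt (nth edge0 g i), [seq emit (xout (nth edge0 g i)) r | r <- (tape_of c i).2]).
Proof. by move=> lt_i; rewrite /tape_of nth_mkseq. Qed.

Lemma states_advance c g : sync g -> states_of (advance c g) = gtgt g.
Proof.
move=> [sg _ _]; apply: (@eq_from_nth _ (0, 0)).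
  by rewrite !size_map size_iota.
rewrite size_map size_advance => i lt_i.
rewrite (nth_map tape0) ?size_advance // -/(tape_of _ _) tape_advance //.
by rewrite (nth_map edge0) ?sg.
Qed.

Lemma stepP c c' : size c = K -> size c' = K ->
  reflect (exists g, [/\ sync g, gsrc g = states_of c & c' = advance c g])
    (step c c').
Proof.
move=> sc sc'; apply: (iffP hasP) => [[x _ /allP Hx] | [g [sg Eg ->]]].
  have ex i : i < K -> exists2 e, e \in edges_of i & tape_step x (tape_of c i) (tape_of c' i) e.
    by move=> lt_i; apply/hasP/Hx; rewrite mem_iota.
  pose g := mkseq (fun i => nth edge0 (edges_of i)
    (find (tape_step x (tape_of c i) (tape_of c' i)) (edges_of i))) K.
  have gP i : i < K -> nth edge0 g i \in edges_of i /\
      tape_step x (tape_of c i) (tape_of c' i) (nth edge0 g i).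
    move=> lt_i; rewrite nth_mkseq //.
    have has_i : has (tape_step x (tape_of c i) (tape_of c' i)) (edges_of i).
      by apply/hasP/ex.
    by rewrite mem_nth -?has_find // nth_find.
  have sg : size g = K by rewrite size_mkseq.
  clearbody g; exists g; split.
  - split=> // [i /gP[] //|]; exists x => i /gP[_ /and4P[/eqP //]].
  - apply: (@eq_from_nth _ (0, 0)); rewrite !size_map ?sc // sg => i lt_i.
    rewrite (nth_map edge0) ?sg // (nth_map tape0) ?sc // -/(tape_of _ _).
    by have [_ /and4P[_ /eqP]] := gP i lt_i.
  - apply: (@eq_from_nth _ tape0); rewrite ?size_advance ?sc' // => i lt_i.
    rewrite -/(tape_of _ _) -/(tape_of (advance c g) i) tape_advance //.
    have [_ /and4P[_ _ /eqP-> /eqP->]] := gP i lt_i.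
    by case: (tape_of c' i).
have [size_g g_in [x Ex]] := sg.
(* The common label is among [inputs] because transition 0 carries it, and there is one as [K] is
   positive. *)
exists x; first by rewrite -(Ex 0 K_gt0); apply: mem_inputs (g_in 0 _).
apply/allP => i; rewrite mem_iota => /andP[_ lt_i]; apply/hasP.
exists (nth edge0 g i); first exact: g_in.
apply/and4P; rewrite tape_advance // Ex // !eqxx; split=> //.
have := congr1 (fun s => nth (0, 0) s i) Eg.
by rewrite (nth_map edge0) ?size_g // (nth_map tape0) ?sc // => ->.
Qed.

Lemma mem_configs c : reflect
  [/\ size c = K, {subset states_of c <= states}
    & forall i, i < K -> size (tape_of c i).2 = K /\
        forall j, j < K -> size (reg c i j).1 <= size clock /\
          (reg c i j).2 \in None :: outputs]
  (c \in configs).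
Proof.
rewrite mem_pow; apply: (iffP andP) => [[/eqP sc /allP cT] | [sc cQ cR]].
  split=> // [q /mapP[d /cT /allpairsP[[q' rs] /= [q_in _ ->]] ->] //|i lt_i].
  have /allpairsP[[q rs] /= [_]] : tape_of c i \in tapes.
    by apply: cT; apply: mem_nth; rewrite sc.
  rewrite mem_pow => /andP[/eqP size_rs /allP rsR] Ec.
  rewrite /reg Ec; split=> // j lt_j.
  have /allpairsP[[n y] /= [n_in y_in ->]] : nth register0 rs j \in registers.
    by apply: rsR; rewrite mem_nth ?size_rs.
  by rewrite -mem_suffixes.
rewrite sc eqxx; split=> //; apply/(all_nthP tape0) => i; rewrite sc => lt_i.
have [size_rs rsR] := cR i lt_i.
apply/allpairsP; exists (tape_of c i); split; last by rewrite /tape_of; case: (nth _ _ _).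
  by apply: cQ; apply: map_f; rewrite mem_nth ?sc.
rewrite mem_pow size_rs eqxx; apply/(all_nthP register0) => j; rewrite size_rs => lt_j.
have [n_le y_in] := rsR j lt_j.
apply/allpairsP; exists (reg c i j); split=> //; last by rewrite /reg; case: (nth _ _ _).
by rewrite mem_suffixes.
Qed.

Lemma emit_fst y r : size (emit y r).1 <= size r.1.
Proof.
case: r => n z; rewrite /emit; case: ifP => // _; case: n => //= _ n.
Qed.

Lemma emit_snd y r (l : seq onat) : y \in l -> r.2 \in l -> (emit y r).2 \in l.
Proof. by case: r => n z; rewrite /emit; do 3 (case: ifP => //= _). Qed.

Lemma reg_advance c g i j : i < K -> j < size (tape_of c i).2 ->
  reg (advance c g) i j = emit (xout (nth edge0 g i)) (reg c i j).
Proof.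
by move=> lt_i lt_j; rewrite /reg tape_advance //= (nth_map register0).
Qed.

(** Counters never increase and observed letters come from transitions, so the finite space of
    configurations is closed under steps. *)
Lemma advance_configs c g : c \in configs -> sync g -> advance c g \in configs.
Proof.
move=> /mem_configs[sc cQ cR] sg; have [size_g g_in _] := sg.
apply/mem_configs; rewrite states_advance // size_advance; split=> //.
  move=> q /(nthP (0, 0))[i]; rewrite size_map size_g => lt_i <-.
  rewrite (nth_map edge0) ?size_g //.
  by have /andP[] := edges_wf lt_i (g_in i lt_i).
move=> i lt_i; have [size_rs rsR] := cR i lt_i.
rewrite {1}tape_advance // size_map; split=> // j lt_j.
have [n_le y_in] := rsR j lt_j.
rewrite reg_advance ?size_rs //; split.
  exact: leq_trans (emit_fst _ _) n_le.
by apply: emit_snd => //; rewrite inE (mem_outputs lt_i) ?orbT ?g_in.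
Qed.

Definition run (c : seq tape) (gs : seq (seq xedge)) := foldl advance c gs.

Lemma run_configs c gs : c \in configs -> {in gs, forall g, sync g} ->
  run c gs \in configs.
Proof.
elim: gs c => //= g gs IH c c_in gsP; apply: IH.
  by apply: advance_configs => //; apply: gsP; apply: mem_head.
by move=> h h_in; apply: gsP; rewrite inE h_in orbT.
Qed.

Lemma states_run c gs : {in gs, forall g, sync g} ->
  states_of (run c gs) = last (states_of c) [seq gtgt g | g <- gs].
Proof.
elim: gs c => //= g gs IH c gsP; rewrite IH.
  by rewrite states_advance //; apply: gsP; apply: mem_head.
by move=> h h_in; apply: gsP; rewrite inE h_in orbT.
Qed.

Lemma reg_run c gs i j : i < K -> j < size (tape_of c i).2 ->
  reg (run c gs) i j = emits (reg c i j) (outs i gs).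
Proof.
elim: gs c => //= g gs IH c lt_i lt_j.
by rewrite IH // ?reg_advance // tape_advance // size_map.
Qed.

Lemma run_rcons c gs g : run c (rcons gs g) = advance (run c gs) g.
Proof. by rewrite /run foldl_rcons. Qed.

Definition reached (n : nat) : seq (seq tape) :=
  iter n next [seq c <- configs | is_init c].

Lemma foldl_iter (T : Type) (f : T -> T) z (l : seq unit) :
  foldl (fun z _ => f z) z l = iter (size l) f z.
Proof. by elim: l z => //= _ l IH z; rewrite IH -iterSr. Qed.

Lemma reachedP n c' : reflect
  (exists c gs, [/\ c \in configs, is_init c, size gs = n,
     walk gsrc gtgt (states_of c) gs (states_of c') /\ {in gs, forall g, sync g}
     & c' = run c gs])
  (c' \in reached n).
Proof.
have configsS m c : c \in reached m -> c \in configs.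
  by case: m => [|m]; rewrite /reached /= mem_filter => /andP[].
have sizeC c : c \in configs -> size c = K by case/mem_configs.
apply: (iffP idP) => [|[c [gs [c_in c_init <- [wgs gsP] Ec']]]].
  elim: n c' => [|n IH] c'; rewrite /reached /= mem_filter.
    move=> /andP[c_init c_in]; exists c', [::]; split=> //; split; rewrite //= ?eqxx.
  move=> /andP[/hasP[c1 c1_in st] c'_in].
  have [c [gs [c_in c_init <- [wgs gsP] Ec1]]] := IH c1 c1_in.
  have /stepP [||g [sg Eg Ec']] := st; [exact/sizeC/configsS/c1_in | exact: sizeC |].
  exists c, (rcons gs g); split=> //; first by rewrite size_rcons.
    split; last by move=> h; rewrite mem_rcons inE => /predU1P[-> // | /gsP].
    rewrite -cats1; apply: walk_trans wgs _ => /=.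
    by rewrite Eg eqxx /= Ec' states_advance.
  by rewrite run_rcons -Ec1.
rewrite {}Ec' in wgs *; elim/last_ind: gs wgs gsP => [|gs g IH] wgs gsP.
  by rewrite /reached /= mem_filter c_init.
have gsP' : {in gs, forall g, sync g}.
  by move=> h h_in; apply: gsP; rewrite mem_rcons inE h_in orbT.
have sg : sync g by apply: gsP; rewrite mem_rcons mem_head.
rewrite size_rcons /reached /= mem_filter run_configs // andbT.
move: wgs; rewrite -cats1 walk_cat => /andP[wgs] /= /andP[/eqP Eg _].
have Er : states_of (run c gs) = gsrc g by rewrite states_run.
apply/hasP; exists (run c gs); first by apply: IH; rewrite ?states_run.
rewrite cats1 run_rcons; apply/stepP; last by exists g.
  exact/sizeC/run_configs.
exact: size_advance.
Qed.

Lemma searchP : reflect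
  (exists xs gs ys, [/\ sync_run xs gs ys, size gs = size clock
    & exists2 l : nat -> nat -> nat,
        forall i j, l i j = l j i /\ l i j <= size clock
      & forall i j, i < K -> j < K -> i != j ->
          onth (outw i gs) (l i j) <> onth (outw j gs) (l i j)])
  search.
Proof.
rewrite /search foldl_iter -/(reached _).
apply: (iffP hasP) => [[c' /reachedP[c [gs [c_in c_init sgs [wgs gsP] Ec']]]]|].
  move=> c'_final; have [sc cQ cR] := mem_configs _ c_in.
  have rE i j : i < K -> j < K ->
      (reg c' i j).2 = onth (outw i gs) (size (reg c i j).1).
    move=> lt_i lt_j; have [size_rs _] := cR i lt_i.
    rewrite Ec' reg_run ?size_rs // -pmap_outs -emits_onth.
    have /allP/(_ i) := c_init; rewrite mem_iota => /(_ lt_i)/andP[_ /allP/(_ j)].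
    rewrite mem_iota => /(_ lt_j)/andP[_ /eqP <-].
    by case: (reg c i j).
  (* The positions are read off the initial counters; the default 0 makes [l] symmetric and bounded
     for all indices. *)
  pose l i j := if (i < K) && (j < K) then size (reg c i j).1 else 0.
  exists (states_of c), gs, (states_of c'); split=> //.
    split=> //; first by rewrite size_map.
      move=> i lt_i; have /allP/(_ i) := c_init; rewrite mem_iota => /(_ lt_i)/andP[].
      by move=> /hasP[q q_in /eqP Eq] _; rewrite (nth_map tape0) ?sc // -Eq.
    have sc' : size c' = K.
      by have /mem_configs[] : c' \in configs by rewrite Ec' run_configs.
    move=> i lt_i; have /allP/(_ i) := c'_final; rewrite mem_iota => /(_ lt_i)/andP[].
    by move=> /hasP[q q_in /eqP Eq] _; rewrite (nth_map tape0) ?sc' // -Eq.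
  have lC i j : l i j = l j i.
    rewrite /l andbC; case: ifP => // /andP[lt_j lt_i].
    have /allP/(_ i) := c_init; rewrite mem_iota => /(_ lt_i)/andP[_ /allP/(_ j)].
    by rewrite mem_iota => /(_ lt_j)/andP[/eqP ->].
  exists l => i j.
    split=> //; rewrite /l; case: ifP => // /andP[lt_i lt_j].
    by have [_ /(_ j lt_j)[]] := cR i lt_i.
  move=> lt_i lt_j ne_ij; rewrite {2}lC /l lt_i lt_j -!rE // => E.
  have /allP/(_ i) := c'_final; rewrite mem_iota => /(_ lt_i)/andP[_ /allP/(_ j)].
  by rewrite mem_iota E eqxx (negbTE ne_ij) => /(_ lt_j).
move=> [xs [gs [ys [[wgs gsP sxs xsI ysF] sgs [l lP lne]]]]].
pose c := mkseq (fun i => (nth (0, 0) xs i,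
  mkseq (fun j => (nseq (l i j) tt, None : onat)) K)) K.
have sc : size c = K by rewrite size_mkseq.
have tc i : i < K -> tape_of c i =
    (nth (0, 0) xs i, mkseq (fun j => (nseq (l i j) tt, None : onat)) K).
  by move=> lt_i; rewrite /tape_of nth_mkseq.
have rc i j : i < K -> j < K -> reg c i j = (nseq (l i j) tt, None).
  by move=> lt_i lt_j; rewrite /reg tc //= nth_mkseq.
have Ec : states_of c = xs.
  apply: (@eq_from_nth _ (0, 0)); rewrite size_map sc // => i lt_i.
  by rewrite (nth_map tape0) ?sc // -/(tape_of c i) tc.
have c_in : c \in configs.
  apply/mem_configs; split=> //.
    rewrite Ec => q /(nthP (0, 0))[i]; rewrite sxs => lt_i <-.
    exact: init_wf (xsI i lt_i).
  move=> i lt_i; rewrite tc // size_mkseq; split=> // j lt_j.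
  by rewrite rc // size_nseq; have [_] := lP i j.
have c_init : is_init c.
  apply/allP => i; rewrite mem_iota => /andP[_ lt_i]; apply/andP; split.
    by apply/hasP; exists (nth (0, 0) xs i); rewrite ?xsI // tc.
  apply/allP => j; rewrite mem_iota => /andP[_ lt_j].
  by have [Elij _] := lP i j; rewrite !rc //= Elij !eqxx.
have Er : states_of (run c gs) = ys.
  by rewrite states_run // Ec; apply: walk_last wgs.
exists (run c gs).
  by apply/reachedP; exists c, gs; rewrite Er Ec; split.
have r_in := run_configs c_in gsP; have [sr _ _] := mem_configs _ r_in.
apply/allP => i; rewrite mem_iota => /andP[_ lt_i]; apply/andP; split.
  apply/hasP; exists (nth (0, 0) ys i); first exact: ysF.
  by rewrite -Er (nth_map tape0) ?sr.
apply/allP => j; rewrite mem_iota => /andP[_ lt_j].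
case: (eqVneq i j) => //= ne_ij.
rewrite !reg_run ?tc ?size_mkseq // !rc // !emits_onth !size_nseq !pmap_outs.
have [Elij _] := lP i j; rewrite -Elij.
by apply/eqP/lne.
Qed.

End Search.

(** * Synchronization of runs by stuttering *)

Definition stutter (q : xstate) : xedge := (q, ((None, None), q)).

Definition wf_xducer (T : xducer) : Prop :=
  [/\ forall e, e \in T.2.1 -> (e.1 \in T.1) && (xtgt e \in T.1),
      {subset T.2.2.1 <= T.1}, {subset T.2.2.2 <= T.1}
    & forall q, q \in T.1 -> stutter q \in T.2.1].

Definition xaccepts (T : xducer) (u w : seq nat) : Prop :=
  exists x es y, [/\ walk xsrc xtgt x es y, {subset es <= T.2.1},
    x \in T.2.2.1, y \in T.2.2.2 & u = pmap xin es /\ w = pmap xout es].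

(** The [M] empty labels after each letter leave room for the transitions with empty input of any
    path of length at most [M]. *)
Definition padding (M : nat) (u : seq nat) : seq onat :=
  flatten [seq Some b :: nseq M None | b <- u].

Lemma walk_stutter q j : walk xsrc xtgt q (nseq j (stutter q)) q.
Proof. by elim: j => //= j IH; rewrite eqxx. Qed.

(* Stuttering makes the input labels depend only on the input word. *)
Lemma padded_path (T : xducer) (M j : nat) x es y : wf_xducer T ->
    walk xsrc xtgt x es y -> {subset es <= T.2.1} -> x \in T.1 ->
    size es <= j -> j <= M ->
  exists es', [/\ walk xsrc xtgt x es' y, {subset es' <= T.2.1},
    [seq xin e | e <- es'] = nseq j None ++ padding M (pmap xin es)
    & pmap xout es' = pmap xout es].
Proof.
move=> wfT; elim: es x j => [|e es IH] x j /=.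
  move/eqP <- => _ x_in _ _; exists (nseq j (stutter x)); split.
  - exact: walk_stutter.
  - by move=> e /nseqP[-> _]; case: wfT => _ _ _; apply.
  - by rewrite cats0 map_nseq.
  - by elim: j.
move=> /andP[/eqP Ex wes] es_in x_in lt_j le_M.
have e_in : e \in T.2.1 by apply: es_in; apply: mem_head.
have es_in' : {subset es <= T.2.1}.
  by move=> f f_in; apply: es_in; rewrite inE f_in orbT.
have tgt_in : xtgt e \in T.1 by case: wfT => /(_ e e_in)/andP[].
(* Here [j] is the number of empty labels left before the next letter. When a letter is read, they
   are filled with stuttering and [M] new ones follow; a transition with empty input uses up one of
   them. *)
case Ein: (xin e) => [b|] /=.
  have [|es' [w' in' Exin Exout]] := IH _ M wes es_in' tgt_in _ (leqnn M).
    exact: leq_trans (ltnW lt_j) le_M.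
  exists (nseq j (stutter x) ++ e :: es'); split.
  - by apply: walk_trans (walk_stutter x j) _; rewrite /= Ex eqxx.
  - move=> f; rewrite mem_cat inE => /or3P[/nseqP[-> _]|/eqP -> //|/in' //].
    by case: wfT => _ _ _; apply.
  - by rewrite map_cat /= map_nseq Ein Exin.
  - rewrite pmap_cat /= Exout (_ : pmap _ (nseq _ _) = [::]) //.
    by elim: (j).
case: j lt_j le_M => // j lt_j le_M.
have [||es' [w' in' Exin Exout]] := IH _ j wes es_in' tgt_in; [by [] | exact: ltnW |].
exists (e :: es'); split; rewrite /= ?Ex ?eqxx ?Ein ?Exin ?Exout //.
by move=> f; rewrite inE => /predU1P[-> // | /in'].
Qed.

Section Synchronize.
Variables (K : nat) (Ts : seq xducer).
Hypothesis sizeTs : size Ts = K.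
Hypothesis K_gt0 : 0 < K.
Hypothesis wfTs : forall i, i < K -> wf_xducer (nth xducer0 Ts i).

Lemma sub_states i q : i < K -> q \in (nth xducer0 Ts i).1 -> q \in states Ts.
Proof.
move=> lt_i q_in; apply/flattenP; exists (nth xducer0 Ts i).1 => //.
by apply/mapP; exists (nth xducer0 Ts i); rewrite ?mem_nth ?sizeTs.
Qed.

(** Paths with the same sequence of input labels have the same length, so they can be read column by
    column, each column being a synchronous transition. *)
Lemma transpose_paths (zs : seq onat) (x y : nat -> xstate) (es : nat -> seq xedge) :
    (forall i, i < K -> [/\ walk xsrc xtgt (x i) (es i) (y i),
       {subset es i <= edges_of Ts i} & [seq xin e | e <- es i] = zs]) ->
  exists gs, [/\ walk gsrc gtgt (mkseq x K) gs (mkseq y K),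
    {in gs, forall g, sync K Ts g}
    & forall i, i < K -> outw i gs = pmap xout (es i)].
Proof.
elim: zs x es => [|z zs IH] x es esP.
  have es0 i : i < K -> es i = [::] by case/esP => _ _; case: (es i).
  exists [::]; split=> //= [|i /es0 ->] //.
  apply/eqP/eq_in_map => i; rewrite mem_iota => /andP[_ lt_i].
  by have [] := esP i lt_i; rewrite es0 //= => /eqP.
pose e i := head edge0 (es i).
have Ees i : i < K -> es i = e i :: behead (es i).
  by case/esP => _ _; rewrite /e; case: (es i).
have [i lt_i|gs [wgs gsP outP]] := IH (fun i => xtgt (e i)) (fun i => behead (es i)).
  have [] := esP i lt_i; rewrite {1 2 3}Ees //= => /andP[_ wi] sub [_ Ez].
  by split=> // f f_in; apply: sub; rewrite inE f_in orbT.
have e_in i : i < K -> e i \in edges_of Ts i /\ xin (e i) = z /\ xsrc (e i) = x i.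
  move=> lt_i; have [] := esP i lt_i; rewrite {1 2 3}Ees //= => /andP[/eqP -> _] sub [-> _].
  by split=> //; apply: sub; apply: mem_head.
exists (mkseq e K :: gs); split.
- rewrite /= /gtgt -map_comp wgs andbT; apply/eqP; rewrite /gsrc -map_comp.
  by apply/eq_in_map => i; rewrite mem_iota => /andP[_ /e_in[_ [_]]].
- move=> g; rewrite inE => /predU1P[-> | /gsP //]; split; first exact: size_mkseq.
    by move=> i lt_i; rewrite nth_mkseq //; have [] := e_in i lt_i.
  by exists z => i lt_i; rewrite nth_mkseq //; have [_ []] := e_in i lt_i.
move=> i lt_i; rewrite /outw /= nth_mkseq // -/(outw i gs) outP //.
by rewrite [in RHS]Ees.
Qed.

Lemma sync_runP :
  (exists xs gs ys, sync_run K Ts xs gs ys /\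
     forall i j, i < K -> j < K -> i != j -> outw i gs <> outw j gs) <->
  (exists u w, (forall i, i < K -> xaccepts (nth xducer0 Ts i) u (w i)) /\
     forall i j, i < K -> j < K -> i != j -> w i <> w j).
Proof.
split=> [[xs [gs [ys [[wgs gsP sxs xsI ysF] dist]]]] | [u [w [acc dist]]]].
  pose es i := [seq nth edge0 g i | g <- gs].
  have xinE i : i < K -> [seq xin e | e <- es i] = [seq xin e | e <- es 0].
    move=> lt_i; rewrite /es -!map_comp; apply/eq_in_map => g /gsP[_ _ [x Ex]] /=.
    by rewrite !Ex.
  exists (pmap id [seq xin e | e <- es 0]), (fun i => outw i gs); split=> // i lt_i.
  exists (nth (0, 0) xs i), (es i), (nth (0, 0) ys i); split.
  - elim: gs xs {xsI dist xinE} @es wgs gsP sxs => [|g gs IH] xs /=.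
      by move/eqP ->.
    move=> /andP[/eqP Eg wgs] gsP sxs.
    have [sg _ _] : sync K Ts g by apply: gsP; apply: mem_head.
    rewrite -Eg (nth_map edge0) ?sg // eqxx /=.
    have := IH _ wgs; rewrite (nth_map edge0) ?sg //; apply.
      by move=> h h_in; apply: gsP; rewrite inE h_in orbT.
    by rewrite size_map.
  - by move=> e /mapP[g /gsP[_ /(_ i lt_i) e_in _] ->].
  - exact: xsI.
  - exact: ysF.
  - split; first by rewrite -(xinE i lt_i); elim: (es i) => //= e s <-.
    by rewrite /outw /es; elim: (gs) => //= g s <-.
have /choice[f fP] : forall i, exists t : xstate * seq xedge * xstate, i < K ->
    [/\ walk xsrc xtgt t.1.1 t.1.2 t.2, {subset t.1.2 <= edges_of Ts i},
      t.1.1 \in init_of Ts i, t.2 \in final_of Ts i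
      & u = pmap xin t.1.2 /\ w i = pmap xout t.1.2].
  move=> i; case: (ltnP i K) => [/acc[x [es [y H]]] | _].
    by exists (x, es, y).
  by exists ((0, 0), [::], (0, 0)).
(* One amount of padding that suffices for all the accepting paths at once. *)
pose M := \max_(i < K) size (f i).1.2.
have /choice[h hP] : forall i, exists es, i < K ->
    [/\ walk xsrc xtgt (f i).1.1 es (f i).2, {subset es <= edges_of Ts i},
      [seq xin e | e <- es] = nseq M None ++ padding M u & pmap xout es = w i].
  move=> i; case: (ltnP i K) => [lt_i | _]; last by exists [::].
  have [wi sub xI yF [-> ->]] := fP i lt_i.
  have x_in : (f i).1.1 \in (nth xducer0 Ts i).1 by have [_ H _ _] := wfTs lt_i; apply: H.
  have le_M : size (f i).1.2 <= M by apply: (leq_bigmax (Ordinal lt_i)).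
  have [es [? ? ? ?]] := padded_path (wfTs lt_i) wi sub x_in le_M (leqnn M).
  by exists es.
have [i lt_i | gs [wgs gsP outP]] := transpose_paths (zs := nseq M None ++ padding M u)
    (x := fun i => (f i).1.1) (y := fun i => (f i).2) (es := h).
  by have [] := hP i lt_i.
exists (mkseq (fun i => (f i).1.1) K), gs, (mkseq (fun i => (f i).2) K); split.
  split=> //; first by rewrite size_mkseq.
    by move=> i lt_i; rewrite nth_mkseq //; have [] := fP i lt_i.
  by move=> i lt_i; rewrite nth_mkseq //; have [] := fP i lt_i.
move=> i j lt_i lt_j ne_ij; rewrite !outP //.
by have [_ _ _ ->] := hP i lt_i; have [_ _ _ ->] := hP j lt_j; apply: dist.
Qed.

(** The bound is that of [short_distinct_walk] for the synchronous product, whose vertices are the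
    K-tuples of states. A mismatch position is at most the length of an output, hence of the run, so
    the clock also bounds the counters. *)
Lemma search_correct (clock : seq unit) :
    pump_bound (2 ^ (K * K) * size (states Ts) ^ K) (K * K) <= size clock ->
  search K clock Ts <->
  exists u w, (forall i, i < K -> xaccepts (nth xducer0 Ts i) u (w i)) /\
     forall i j, i < K -> j < K -> i != j -> w i <> w j.
Proof.
move=> le_clock; rewrite -sync_runP.
have edges_wf i e : i < K -> e \in edges_of Ts i ->
    (e.1 \in states Ts) && (xtgt e \in states Ts).
  move=> lt_i e_in; have [H _ _ _] := wfTs lt_i.
  by have /andP[H1 H2] := H e e_in; rewrite !(sub_states lt_i).
have init_wf i q : i < K -> q \in init_of Ts i -> q \in states Ts.
  by move=> lt_i q_in; have [_ H _ _] := wfTs lt_i; apply: sub_states lt_i (H q q_in).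
split=> [/searchP[]// xs [gs [ys [Hrun sgs [l lP lne]]]] | ].
  exists xs, gs, ys; split=> // i j lt_i lt_j ne_ij Ew.
  by apply: (lne i j lt_i lt_j ne_ij); rewrite Ew.
move=> [xs [gs [ys [[wgs gsP sxs xsI ysF] dist]]]].
have srcP g : sync K Ts g -> gsrc g \in pow K (states Ts) /\ gtgt g \in pow K (states Ts).
  move=> [sg g_in _]; rewrite !mem_pow !size_map sg eqxx.
  by split; apply/allP => q /mapP[e /(nthP edge0)[i]]; rewrite sg => lt_i <- ->;
    have /andP[] := edges_wf i _ lt_i (g_in i lt_i).
have sVS : {subset visits gtgt xs gs <= pow K (states Ts)}.
  move=> q; rewrite /visits inE => /predU1P[-> | /mapP[g /gsP/srcP[_ g_in] ->//]].
  rewrite mem_pow sxs eqxx; apply/(all_nthP (0, 0)) => i; rewrite sxs => lt_i.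
  exact: init_wf (xsI i lt_i).
pose out (i : 'I_K) (g : seq xedge) := xout (nth edge0 g i).
have [|gs' [wgs' sub_gs' dist' le_gs']] := short_distinct_walk (out := out) wgs sVS.
  by move=> i j ne_ij; apply: dist.
rewrite size_pow in le_gs'.
have gsP' : {in gs', forall g, sync K Ts g} by move=> g /sub_gs'/gsP.
have sys : size ys = K.
  have <- := walk_last wgs; case/lastP: (gs) gsP => [|s g] gsP //.
  rewrite map_rcons last_rcons size_map.
  by have [] := gsP g; rewrite ?mem_rcons ?mem_head.
(* The short run is prolonged to the length of the clock by stuttering in its last states, which
   leaves the outputs unchanged. *)
pose m := size clock - size gs'; pose st := [seq stutter q | q <- ys].
have st_sync : sync K Ts st.
  split; first by rewrite size_map.
    move=> i lt_i; rewrite (nth_map (0, 0)) ?sys //.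
    by have [_ _ H1 H2] := wfTs lt_i; apply/H2/H1/ysF.
  by exists None => i lt_i; rewrite (nth_map (0, 0)) ?sys.
have outw_st i : i < K -> outw i (gs' ++ nseq m st) = outw i gs'.
  move=> lt_i; rewrite /outw pmap_cat [X in _ ++ X](_ : _ = [::]) ?cats0 //.
  by elim: (m) => //= m' ->; rewrite (nth_map (0, 0)) ?sys.
have le_m : size gs' <= size clock by apply: leq_trans le_gs' le_clock.
apply/searchP => //; exists xs, (gs' ++ nseq m st), ys; split.
- split=> //.
    have [Es Et] : gsrc st = ys /\ gtgt st = ys.
      by rewrite /gsrc /gtgt -!map_comp !map_id.
    by apply: walk_trans wgs' _; elim: (m) => //= m' IH; rewrite Es Et eqxx.
  by move=> g; rewrite mem_cat => /orP[/gsP' //|/nseqP[-> _]].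
- by rewrite size_cat size_nseq /m subnKC.
exists (fun i j => mismatch (outw i gs') (outw j gs')).
  move=> i j; split; first exact: mismatchC.
  apply: leq_trans (mismatch_le _ _) _; apply: leq_trans _ le_m.
  by rewrite size_pmap count_size.
move=> i j lt_i lt_j ne_ij; rewrite !outw_st //; apply: onth_mismatch.
exact: (dist' (Ordinal lt_i) (Ordinal lt_j)).
Qed.

End Synchronize.

(** * Restriction of a transducer to a regular language *)

(* Machines whose states and letters have been replaced with their names. *)
Notation redge L := (nat * (L * nat))%type.
Notation rmachine L := (seq nat * (seq (redge L) * (seq nat * seq nat)))%type.

Definition rsrc (L : Type) (e : redge L) : nat := e.1.
Definition rtgt (L : Type) (e : redge L) : nat := e.2.2.
Definition rlabel (L : Type) (e : redge L) : L := e.2.1.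

Definition wf_rmachine (L : eqType) (m : rmachine L) : Prop :=
  [/\ forall e, e \in m.2.1 -> (rsrc e \in m.1) && (rtgt e \in m.1),
      {subset m.2.2.1 <= m.1} & {subset m.2.2.2 <= m.1}].

Definition raccepting (L : eqType) (m : rmachine L) (es : seq (redge L)) : Prop :=
  exists p q, [/\ walk (@rsrc L) (@rtgt L) p es q, {subset es <= m.2.1},
    p \in m.2.2.1 & q \in m.2.2.2].

Definition rlang (a : rmachine nat) (w : seq nat) : Prop :=
  exists2 es, raccepting a es & w = [seq rlabel e | e <- es].

Definition rimage (t : rmachine (onat * onat)) (u v : seq nat) : Prop :=
  exists es, [/\ raccepting t es, u = pmap (fun e => (rlabel e).1) es
    & v = pmap (fun e => (rlabel e).2) es].

(** The added loops have empty labels. In the product, the loops of the automaton let it wait while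
    the transducer outputs nothing, and a pair of loops is the stuttering that [wf_xducer] asks
    for. *)
Definition tr_stutters (t : rmachine (onat * onat)) : seq (redge (onat * onat)) :=
  t.2.1 ++ [seq (q, ((None, None), q)) | q <- t.1].

Definition nfa_stutters (a : rmachine nat) : seq (redge onat) :=
  [seq (e.1, (Some e.2.1, e.2.2)) | e <- a.2.1] ++ [seq (q, (None, q)) | q <- a.1].

Definition restrict_edges (t : rmachine (onat * onat)) (a : rmachine nat) : seq xedge :=
  [seq ((ef.1.1, ef.2.1), (ef.1.2.1, (ef.1.2.2, ef.2.2.2))) |
    ef <- [seq ef <- [seq (e, f) | e <- tr_stutters t, f <- nfa_stutters a] |
            ef.1.2.1.2 == ef.2.2.1]].

(** Product construction in which the automaton reads the output of the transducer: it is the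
    outputs that are restricted to the language of [a]. *)
Definition restrict (t : rmachine (onat * onat)) (a : rmachine nat) : xducer :=
  ([seq (q, p) | q <- t.1, p <- a.1],
   (restrict_edges t a,
    ([seq (q, p) | q <- t.2.2.1, p <- a.2.2.1],
     [seq (q, p) | q <- t.2.2.2, p <- a.2.2.2]))).

Definition identity (a : rmachine nat) : rmachine (onat * onat) :=
  (a.1, ([seq (e.1, ((Some e.2.1, Some e.2.1), e.2.2)) | e <- a.2.1], a.2.2)).

Lemma mem_restrict_edges t a z : reflect
  (exists e f, [/\ e \in tr_stutters t, f \in nfa_stutters a,
     (rlabel e).2 = rlabel f
     & z = ((rsrc e, rsrc f), (rlabel e, (rtgt e, rtgt f)))])
  (z \in restrict_edges t a).
Proof.
apply: (iffP mapP) => [[[e f]] | [e [f [e_in f_in Eef ->]]]].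
  rewrite mem_filter => /andP[/eqP Eef /allpairsP[[e' f'] /= [e_in f_in]]].
  by move=> [Ee Ef] ->; exists e, f; rewrite Ee Ef; split=> //; rewrite -Ee -Ef.
exists (e, f) => //; rewrite mem_filter /= -/(rlabel e) -/(rlabel f) Eef eqxx /=.
by apply/allpairsP; exists (e, f).
Qed.

Lemma wf_restrict t a : wf_rmachine t -> wf_rmachine a -> wf_xducer (restrict t a).
Proof.
move=> [tE tI tF] [aE aI aF]; split=> /=.
- move=> z /mem_restrict_edges[e [f [e_in f_in _ ->]]] /=.
  have {e_in} /andP[e1 e2] : (rsrc e \in t.1) && (rtgt e \in t.1).
    by move: e_in; rewrite mem_cat => /orP[/tE //|/mapP[q q_in ->]]; rewrite /= q_in.
  have {f_in} /andP[f1 f2] : (rsrc f \in a.1) && (rtgt f \in a.1).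
    by move: f_in; rewrite mem_cat => /orP[|] /mapP[q q_in ->];
      [apply: aE q_in | rewrite /= q_in].
  by apply/andP; split; apply/allpairsP;
    [exists (rsrc e, rsrc f) | exists (rtgt e, rtgt f)].
- move=> _ /allpairsP[[q p] /= [/tI q_in /aI p_in ->]].
  by apply/allpairsP; exists (q, p).
- move=> _ /allpairsP[[q p] /= [/tF q_in /aF p_in ->]].
  by apply/allpairsP; exists (q, p).
- move=> _ /allpairsP[[q p] /= [q_in p_in ->]]; apply/mem_restrict_edges.
  exists (q, ((None, None), q)), (p, (None, p)); split=> //.
    by rewrite mem_cat; apply/orP; right; apply: (map_f (fun q => (q, (_, q)))).
  by rewrite mem_cat; apply/orP; right; apply: (map_f (fun q => (q, (_, q)))).
Qed.

Lemma wf_identity a : wf_rmachine a -> wf_rmachine (identity a).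
Proof. by move=> [aE aI aF]; split=> //= _ /mapP[e /aE e_in ->]. Qed.

Lemma restrict_split t a q p z q' p' :
    walk xsrc xtgt (q, p) z (q', p') -> {subset z <= restrict_edges t a} ->
  exists es fs, [/\ walk (@rsrc _) (@rtgt _) q es q', {subset es <= t.2.1},
      pmap xin z = pmap (fun e => (rlabel e).1) es
      & pmap xout z = pmap (fun e => (rlabel e).2) es] /\
    [/\ walk (@rsrc _) (@rtgt _) p fs p', {subset fs <= a.2.1}
      & pmap xout z = [seq rlabel f | f <- fs]].
Proof.
elim: z q p => [|x z IH] q p /=.
  by move=> /eqP[-> ->] _; exists [::], [::]; rewrite /= !eqxx.
move=> /andP[/eqP Ex wz] sub.
have [e [f [e_in f_in Eef Ez]]] := mem_restrict_edges _ _ _ (sub x (mem_head _ _)).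
rewrite {}Ez /= in Ex wz *; case: Ex => Eq Ep.
have [|es [fs [[wes es_in Ein Eout] [wfs fs_in Efs]]]] := IH _ _ wz.
  by move=> y y_in; apply: sub; rewrite inE y_in orbT.
(* A genuine transition is prepended, whereas an added loop is left out, having empty labels and
   equal ends. The automaton component is treated likewise below. *)
have {IH sub wz e_in} [es' [wes' es'_in Ein' Eout']] : exists es',
    [/\ walk (@rsrc _) (@rtgt _) q es' q', {subset es' <= t.2.1},
      oapp (cons^~ (pmap xin z)) (pmap xin z) (rlabel e).1 =
        pmap (fun e => (rlabel e).1) es'
      & oapp (cons^~ (pmap xout z)) (pmap xout z) (rlabel e).2 =
        pmap (fun e => (rlabel e).2) es'].
  move: e_in; rewrite mem_cat => /orP[e_in | /mapP[r _ Er]].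
    exists (e :: es); split; rewrite /= ?Eq ?eqxx ?Ein ?Eout //.
    by move=> y; rewrite inE => /predU1P[-> | /es_in].
  by exists es; rewrite -Eq {}Er in wes *.
have {f_in} [fs' [wfs' fs'_in Efs']] : exists fs',
    [/\ walk (@rsrc _) (@rtgt _) p fs' p', {subset fs' <= a.2.1}
      & oapp (cons^~ (pmap xout z)) (pmap xout z) (rlabel f) =
        [seq rlabel f | f <- fs']].
  move: f_in; rewrite mem_cat => /orP[/mapP[g g_in Eg] | /mapP[r _ Er]].
    exists (g :: fs); split; rewrite ?Eg /= -?Efs //.
      by rewrite -Ep Eg eqxx; rewrite Eg in wfs.
    by move=> y; rewrite inE => /predU1P[-> | /fs_in].
  by exists fs; rewrite -Ep {}Er in wfs *.
exists es', fs'; rewrite -Efs' -Eout' -Ein'; split; split=> //.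
by rewrite /xout /= -Eef.
Qed.

Lemma restrict_merge t a q p es fs q' p' : wf_rmachine a -> p \in a.1 ->
    walk (@rsrc _) (@rtgt _) q es q' -> {subset es <= t.2.1} ->
    walk (@rsrc _) (@rtgt _) p fs p' -> {subset fs <= a.2.1} ->
    pmap (fun e => (rlabel e).2) es = [seq rlabel f | f <- fs] ->
  exists z, [/\ walk xsrc xtgt (q, p) z (q', p'), {subset z <= restrict_edges t a},
    pmap xin z = pmap (fun e => (rlabel e).1) es
    & pmap xout z = pmap (fun e => (rlabel e).2) es].
Proof.
move=> [aE _ _]; elim: es q p fs => [|e es IH] q p fs p_in /=.
  case: fs => // /eqP -> _ /eqP -> _ _.
  by exists [::]; rewrite /= eqxx.
move=> /andP[/eqP Eq wes] es_in.
have e_in : e \in t.2.1 by apply: es_in; apply: mem_head.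
have es_in' : {subset es <= t.2.1}.
  by move=> y y_in; apply: es_in; rewrite inE y_in orbT.
case Eo: (rlabel e).2 => [b|] /=.
  case: fs => //= f fs /andP[/eqP Ep wfs] fs_in [Eb Efs].
  have f_in : f \in a.2.1 by apply: fs_in; apply: mem_head.
  have /andP[_ tgt_in] := aE f f_in.
  have [|z [wz z_in Ein Eout]] := IH _ _ fs tgt_in wes es_in' wfs _ Efs.
    by move=> y y_in; apply: fs_in; rewrite inE y_in orbT.
  exists (((rsrc e, rsrc f), (rlabel e, (rtgt e, rtgt f))) :: z); split.
  - by rewrite /= Eq Ep eqxx.
  - move=> y; rewrite inE => /predU1P[-> | /z_in //]; apply/mem_restrict_edges.
    exists e, (rsrc f, (Some b, rtgt f)); rewrite mem_cat e_in Eo; split=> //.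
    rewrite mem_cat; apply/orP; left; apply/mapP; exists f => //.
    by rewrite Eb.
  - by rewrite /= Ein.
  - by rewrite /= Eout /xout /= Eo.
move=> wfs fs_in Efs.
have [z [wz z_in Ein Eout]] := IH _ _ fs p_in wes es_in' wfs fs_in Efs.
exists (((rsrc e, p), (rlabel e, (rtgt e, p))) :: z); split.
- by rewrite /= Eq eqxx.
- move=> y; rewrite inE => /predU1P[-> | /z_in //]; apply/mem_restrict_edges.
  exists e, (p, (None, p)); rewrite mem_cat e_in Eo; split=> //.
  by rewrite mem_cat; apply/orP; right; apply: (map_f (fun q => (q, (_, q)))).
- by rewrite /= Ein.
- by rewrite /= Eout /xout /= Eo.
Qed.

Lemma xaccepts_restrict t a u w : wf_rmachine a ->
  xaccepts (restrict t a) u w <-> rimage t u w /\ rlang a w.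
Proof.
move=> wfa; split=> [[[q p] [z [[q' p'] [wz z_in]]]] | ].
  move=> /allpairsP[[q1 p1] /= [q1I p1I [Eq Ep]]].
  move=> /allpairsP[[q2 p2] /= [q2F p2F [Eq' Ep']]] [-> ->].
  subst; have [es [fs [[wes es_in Ein Eout] [wfs fs_in Efs]]]] := restrict_split wz z_in.
  split; first by exists es; split=> //; exists q1, q2.
  by exists fs => //; exists p1, p2.
move=> [[es [[q [q' [wes es_in qI q'F]]] -> Ew]] [fs [p [p' [wfs fs_in pI p'F]]] Ew']].
have p_in : p \in a.1 by case: wfa => _ H _; apply: H.
have [z [wz z_in Ein Eout]] := restrict_merge wfa p_in wes es_in wfs fs_in (etrans (esym Ew) Ew').
exists (q, p), z, (q', p'); split=> //.
- by apply/allpairsP; exists (q, p).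
- by apply/allpairsP; exists (q', p').
- by rewrite Ein Eout.
Qed.

Lemma rimage_identity a u w : rimage (identity a) u w <-> rlang a w /\ u = w.
Proof.
pose lift (e : redge nat) : redge (onat * onat) :=
  (e.1, ((Some e.2.1, Some e.2.1), e.2.2)).
have liftE es : pmap (fun e => (rlabel e).1) (map lift es) = map (@rlabel _) es /\
    pmap (fun e => (rlabel e).2) (map lift es) = map (@rlabel _) es.
  by elim: es => //= e es [-> ->].
have walk_lift p es q : walk (@rsrc _) (@rtgt _) p (map lift es) q =
    walk (@rsrc _) (@rtgt _) p es q.
  by elim: es p => //= e es IH p; rewrite IH.
split=> [[es [[p [q [wes es_in pI qF]]] -> ->]] | [[es [p [q [wes es_in pI qF]]] ->] ->]].
  have [fs Efs fs_in] : exists2 fs, es = map lift fs & {subset fs <= a.2.1}.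
    elim: es {wes} es_in => [|e es IH] es_in; first by exists [::].
    have [|fs -> fs_in] := IH.
      by move=> y y_in; apply: es_in; rewrite inE y_in orbT.
    have /mapP[f f_in ->] := es_in e (mem_head _ _).
    exists (f :: fs) => // y; rewrite inE => /predU1P[-> //|/fs_in //].
  rewrite {}Efs walk_lift in wes *; have [-> ->] := liftE fs; split=> //.
  by exists fs => //; exists p, q.
exists (map lift es); have [-> ->] := liftE es; split=> //.
exists p, q; rewrite walk_lift; split=> // _ /mapP[e /es_in e_in ->].
exact: (map_f lift).
Qed.

(** * Running time of the search *)

Section Combinators.
Context {X A : Type} {dX : data X} {dA : data A}.

Lemma ptime_nth (d : A) i (l : X -> seq A) :
  ptime l -> ptime (fun x => nth d (l x) i).
Proof.
elim: i l => [|i IH] l pl.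
  by apply: (ptime_ext (f := fun x => head d (l x))); [move=> x; case: (l x) | pt].
apply: (ptime_ext (f := fun x => nth d (behead (l x)) i)).
  by move=> x; rewrite nth_behead.
by apply: IH; pt.
Qed.

(** The list does not depend on the input, so the loop is unrolled in the text of the program, with
    a separate test for each entry. This is how the indices below the constant [K] are handled. *)
Lemma ptime_all_const (T : Type) (s : seq T) (p : X -> T -> bool) :
  (forall i, ptime (fun x => p x i)) -> ptime (fun x => all (p x) s).
Proof.
move=> pp; elim: s => [|i s IH] /=; first by pt.
exact: ptime_andb.
Qed.

Lemma ptime_orb (b b' : X -> bool) :
  ptime b -> ptime b' -> ptime (fun x => b x || b' x).
Proof. by move=> pb pb'; apply: (ptime_if pb); pt. Qed.

End Combinators.

Lemma ptime_pow (X A : Type) {dX : data X} {dA : data A} n (l : X -> seq A) :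
  ptime l -> ptime (fun x => pow n (l x)).
Proof.
move=> pl; elim: n => [|n IH] /=; first by pt.
apply: (ptime_allpairs (l' := fun x _ => pow n (l x)) (f := fun _ a s => a :: s)) => //.
  by apply: (ptime_comp _ IH); pt.
by pt.
Qed.

Notation eq_ptime A := (ptime (fun y : A * A => y.1 == y.2)).

Lemma eq_ptime_nat : eq_ptime nat.
Proof. by pt. Qed.

Lemma eq_ptime_onat : eq_ptime (option nat).
Proof. by pt. Qed.

Lemma eq_ptime_unit : eq_ptime unit.
Proof.
apply: (ptime_ext (f := fun=> true)); first by case=> [[] []].
exact: ptime_const.
Qed.

Lemma eq_ptime_pair (A B : eqType) {dA : data A} {dB : data B} :
  eq_ptime A -> eq_ptime B -> eq_ptime (A * B)%type.
Proof.
move=> pA pB.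
apply: (ptime_ext (f := fun y => (y.1.1 == y.2.1) && (y.1.2 == y.2.2))).
  by move=> [[a b] [a' b']].
apply: ptime_andb.
  by apply: (ptime_app2 (p := fun a a' => a == a') pA); pt.
by apply: (ptime_app2 (p := fun a a' => a == a') pB); pt.
Qed.

(** Only leaves can be compared directly. A fold over one list consumes the other, recording whether
    they have agreed so far; the lists are equal if they have and nothing is left. *)
Lemma eq_ptime_seq (A : eqType) {dA : data A} (a0 : A) :
  eq_ptime A -> eq_ptime (seq A).
Proof.
move=> pA.
pose f (r : bool * seq A) (a : A) :=
  (r.1 && ~~ nilp r.2 && (head a0 r.2 == a), behead r.2).
have fE (s t : seq A) b : ((foldl f (b, t) s).1 && nilp (foldl f (b, t) s).2) =
    b && (s == t).
  elim: s t b => [|a s IH] [|a' t] b //=; rewrite IH /= ?andbF //=.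
  by rewrite andbT -andbA eqseq_cons eq_sym.
apply: (ptime_ext (f := fun y => (foldl f (true, y.2) y.1).1 &&
    nilp (foldl f (true, y.2) y.1).2)).
  by move=> y; rewrite fE.
enough (ptime (fun y : seq A * seq A => foldl f (true, y.2) y.1)) by pt.
apply: (ptime_foldl (b0 := fun y => (true, y.2)) (f := fun=> f)); [by pt | by pt | |].
  apply: ptime_pair; last by pt.
  apply: ptime_andb; first by pt.
  by apply: (ptime_app2 (p := fun a a' => a == a') pA); pt.
(* At most 3 for the boolean and 1 for the pair; the second list only shrinks. *)
exists (fun y => 4 + dsize y.2).
  apply: polyb_add; first exact: polyb_const.
  by have [] : ptime (fun y : seq A * seq A => y.2) by pt.
move=> [s t] n /=; elim: (take n s) true t => [|a s' IH] b t /=.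
  by rewrite dsize_pair; have := dsize_bool b; lia.
apply: leq_trans (IH _ _) _; rewrite leq_add2l; case: t => //= a' t.
by rewrite dsize_cons; lia.
Qed.

Lemma ptime_suffixes (X A : Type) {dX : data X} {dA : data A} (l : X -> seq A) :
  ptime l -> ptime (fun x => suffixes (l x)).
Proof.
move=> pl; have [lb _] := pl.
pose f (a : A) (ss : seq (seq A)) := (a :: head [::] ss) :: ss.
have fE s : foldr f [:: [::]] s = suffixes s.
  by elim: s => //= a s ->; case: s.
apply: (ptime_ext (f := fun x => foldr f [:: [::]] (l x))) => //.
apply: (ptime_foldr (f := fun=> f)) => //; [by pt | by rewrite /f; pt |].
exists (fun x => (dsize (l x)).+1 * (dsize (l x)).+1).
  by apply: polyb_mul; apply: polyb_S.
move=> x n; rewrite fE.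
have le_s (s : seq A) : dsize (suffixes s) <= (size s).+1 * (dsize s).+1 + 1.
  elim: s => // a s IH /=; rewrite !dsize_cons.
  have := leq_mul (leqnn (size s).+1) (leqnn (dsize s).+1); nia.
apply: leq_trans (le_s _) _.
have := @dsize_drop _ dA n (l x); have := @size_le_dsize _ dA (drop n (l x)); nia.
Qed.

Lemma ptime_emit (X : Type) {dX : data X} (y : X -> onat) (r : X -> register) :
  ptime y -> ptime r -> ptime (fun x => emit (y x) (r x)).
Proof. by move=> py pr; rewrite /emit; pt. Qed.

Lemma eq_ptime_xstate : eq_ptime xstate.
Proof. exact: eq_ptime_pair eq_ptime_nat eq_ptime_nat. Qed.

Lemma eq_ptime_unary : eq_ptime (seq unit).
Proof. exact: eq_ptime_seq tt eq_ptime_unit. Qed.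

Lemma eq_ptime_registers :
  eq_ptime (seq register).
Proof.
exact: eq_ptime_seq register0 (eq_ptime_pair eq_ptime_unary eq_ptime_onat).
Qed.

Lemma ptime_eq (X : Type) (A : eqType) {dX : data X} {dA : data A} (f g : X -> A) :
  eq_ptime A -> ptime f -> ptime g -> ptime (fun x => f x == g x).
Proof. by move=> pA; apply: (ptime_app2 (p := fun a a' => a == a') pA). Qed.

Ltac ptx := repeat first [pt1 | cbv beta; lazymatch goal with
  | |- @ptime _ _ _ _ (fun x => nth ?d (@?l x) ?i) =>
    apply (@ptime_nth _ _ _ _ d i l)
  | |- @ptime _ _ _ _ (fun x => emit (@?y x) (@?r x)) => apply (@ptime_emit _ _ y r)
  | |- @ptime _ _ _ _ (fun x => @?b x || @?c x) => apply (@ptime_orb _ _ b c)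
  end].

Section SearchTime.
Variable K : nat.

Lemma ptime_tape_step : ptime
  (fun y : onat * tape * tape * xedge => tape_step y.1.1.1 y.1.1.2 y.1.2 y.2).
Proof.
rewrite /tape_step /xin /xsrc /xtgt /xout.
apply: ptime_andb; first by ptx.
apply: ptime_andb; first by apply: ptime_eq eq_ptime_xstate _ _; ptx.
apply: ptime_andb; first by apply: ptime_eq eq_ptime_xstate _ _; ptx.
apply: ptime_eq eq_ptime_registers _ _; last by ptx.
apply: (ptime_map (l := fun y => y.1.1.2.2) _ (f := fun y r => emit y.2.2.1.2 r)); ptx.
Qed.

Lemma ptime_flat_map (X A B : Type) {dX : data X} {dA : data A} {dB : data B}
    (l : X -> seq A) (f : A -> seq B) :
  ptime l -> ptime f -> ptime (fun x => flatten [seq f a | a <- l x]).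
Proof.
move=> pl pf; apply: ptime_flatten; apply: (ptime_map pl (f := fun _ a => f a)).
by apply: (ptime_comp _ pf); pt.
Qed.

Lemma ptime_inputs : ptime inputs.
Proof.
apply: ptime_flat_map; first by pt.
apply: (ptime_map (l := fun T : xducer => T.2.1) _ (f := fun _ e => xin e)); first by pt.
by rewrite /xin; pt.
Qed.

Lemma ptime_outputs : ptime outputs.
Proof.
apply: ptime_flat_map; first by pt.
apply: (ptime_map (l := fun T : xducer => T.2.1) _ (f := fun _ e => xout e)); first by pt.
by rewrite /xout; pt.
Qed.

Lemma ptime_configs :
  ptime (fun y : seq unit * seq xducer => configs K y.1 y.2).
Proof.
apply: ptime_pow; apply: (ptime_allpairs (l' := fun y _ => pow K (registers y.1 y.2))
  (f := fun _ q rs => (q, rs))); last by pt.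
  by apply: ptime_flat_map; pt.
apply: ptime_pow; apply: (ptime_allpairs (l := fun y => suffixes y.1.1)
  (l' := fun y _ => None :: outputs y.1.2) (f := fun _ n z => (n, z))); last by pt.
  by apply: ptime_suffixes; pt.
by apply: ptime_cons; [pt | apply: (ptime_comp _ ptime_outputs); pt].
Qed.

Lemma ptime_step :
  ptime (fun y : seq xducer * seq tape * seq tape => step K y.1.1 y.1.2 y.2).
Proof.
apply: (ptime_has (l := fun y => inputs y.1.1) _ (p := fun y x => all (fun i =>
    has (tape_step x (tape_of y.1.2 i) (tape_of y.2 i)) (edges_of y.1.1 i)) (iota 0 K))).
  by apply: (ptime_comp _ ptime_inputs); pt.
apply: (@ptime_all_const _ _ _ _ (fun y i => has (tape_step y.2 (tape_of y.1.1.2 i)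
  (tape_of y.1.2 i)) (edges_of y.1.1.1 i))) => i.
apply: (ptime_has (l := fun y => edges_of y.1.1.1 i) _
  (p := fun y => tape_step y.2 (tape_of y.1.1.2 i) (tape_of y.1.2 i))).
  by rewrite /edges_of; ptx.
apply: (ptime_comp (f := fun y : seq xducer * seq tape * seq tape * onat * xedge =>
  (y.1.2, tape_of y.1.1.1.2 i, tape_of y.1.1.2 i, y.2)) _ ptime_tape_step).
by rewrite /tape_of; ptx.
Qed.

Lemma ptime_state_in (X : Type) {dX : data X} (l : X -> seq xstate) (q : X -> xstate) :
  ptime l -> ptime q -> ptime (fun x => has (fun p => p == q x) (l x)).
Proof.
move=> pl pq; apply: (ptime_has pl (p := fun x p => p == q x)).
by apply: (ptime_eq eq_ptime_xstate); [pt | apply: (ptime_comp _ pq); pt].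
Qed.

Lemma ptime_is_init :
  ptime (fun y : seq xducer * seq tape => is_init K y.1 y.2).
Proof.
apply: (@ptime_all_const _ _ _ _ (fun y i => _ && _)) => i; apply: ptime_andb.
  by apply: ptime_state_in; rewrite /init_of /tape_of; ptx.
apply: (@ptime_all_const _ _ _ _ (fun y j => _ && _)) => j; rewrite /reg /tape_of.
by apply: ptime_andb; [apply: (ptime_eq eq_ptime_unary) |]; ptx.
Qed.

Lemma ptime_is_final :
  ptime (fun y : seq xducer * seq tape => is_final K y.1 y.2).
Proof.
apply: (@ptime_all_const _ _ _ _ (fun y i => _ && _)) => i; apply: ptime_andb.
  by apply: ptime_state_in; rewrite /final_of /tape_of; ptx.
apply: (@ptime_all_const _ _ _ _ (fun y j => _ || _)) => j; rewrite /reg /tape_of.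
by ptx.
Qed.

Lemma ptime_next : ptime (fun y : seq unit * seq xducer * seq (seq tape) =>
  next K y.1.1 y.1.2 y.2).
Proof.
apply: (ptime_filter (l := fun y => configs K y.1.1 y.1.2) _
  (p := fun y c' => has (fun c => step K y.1.2 c c') y.2)).
  by apply: (ptime_comp _ ptime_configs); pt.
apply: (ptime_has (l := fun y => y.1.2) _ (p := fun y c => step K y.1.1.2 c y.2)).
  by pt.
apply: (ptime_comp (f := fun y : seq unit * seq xducer * seq (seq tape) *
  seq tape * seq tape => (y.1.1.1.2, y.2, y.1.2)) _ ptime_step).
by pt.
Qed.

Lemma ptime_search :
  ptime (fun y : seq unit * seq xducer => search K y.1 y.2).
Proof.
have pinit : ptime (fun y : seq unit * seq xducer =>
    [seq c <- configs K y.1 y.2 | is_init K y.2 c]).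
  apply: (ptime_filter ptime_configs (p := fun y c => is_init K y.2 c)).
  by apply: (ptime_comp (f := fun y => (y.1.2, y.2)) _ ptime_is_init); pt.
have preach : ptime (fun y : seq unit * seq xducer =>
    foldl (fun cs _ => next K y.1 y.2 cs)
      [seq c <- configs K y.1 y.2 | is_init K y.2 c] y.1).
  apply: (ptime_foldl (l := fun y => y.1) _ pinit
    (f := fun y cs _ => next K y.1 y.2 cs)); first by pt.
    by apply: (ptime_comp (f := fun y => (y.1, y.2.1)) _ ptime_next); pt.
  (* Every level is a sublist of [configs], which gives the bound on the accumulator. *)
  exists (fun y => dsize (configs K y.1 y.2)); first by case: ptime_configs.
  move=> y n; rewrite foldl_iter.
  by case: (size _) => [|m]; apply: dsize_filter.
apply: (ptime_has preach (p := fun y c => is_final K y.2 c)).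
by apply: (ptime_comp (f := fun y => (y.1.2, y.2)) _ ptime_is_final); pt.
Qed.

End SearchTime.

(** * The decision procedure and its clock *)

Notation rinstance := (rmachine (onat * onat) * rmachine nat)%type.

(** Track 0 forces the common input into the language and outputs it, so differing from track 0 is
    the condition that an output is not [u]. The identity goes through [restrict] as well, which
    equips it with stuttering loops. *)
Definition tracks (k : nat) (y : rinstance) : seq xducer :=
  restrict (identity y.2) y.2 :: nseq k.+1 (restrict y.1 y.2).

(** A unary number is produced by listing tuples: for [n] states in all there are (n+2)^e of them,
    the two extra entries matching the base in [clock_bound_poly]. *)
Definition clock (e : nat) (y : rinstance) : seq unit :=
  [seq tt | _ <- pow e [:: 0, 0 & y.1.1 ++ y.2.1]].

Definition decide (k e : nat) (y : rinstance) : bool :=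
  ~~ search k.+2 (clock e y) (tracks k y).

Lemma ptime_tr_stutters : ptime tr_stutters.
Proof.
apply: ptime_cat; first by pt.
apply: (ptime_map (l := fun t : rmachine (onat * onat) => t.1) _
  (f := fun _ (q : nat) => (q, ((None : onat, None : onat), q)))); by pt.
Qed.

Lemma ptime_nfa_stutters : ptime nfa_stutters.
Proof.
apply: ptime_cat.
  apply: (ptime_map (l := fun a : rmachine nat => a.2.1) _
    (f := fun _ (e : redge nat) => (e.1, (Some e.2.1, e.2.2)))); by pt.
by apply: (ptime_map (l := fun a : rmachine nat => a.1) _
  (f := fun _ (q : nat) => (q, (None : onat, q)))); pt.
Qed.

Lemma ptime_restrict : ptime (fun y : rinstance => restrict y.1 y.2).
Proof.
have ppairs (l l' : rinstance -> seq nat) : ptime l -> ptime l' ->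
    ptime (fun y => [seq (q, p) | q <- l y, p <- l' y]).
  move=> pl pl'; apply: (ptime_allpairs pl (l' := fun y _ => l' y)
    (f := fun _ (q p : nat) => (q, p))); last by pt.
  by apply: (ptime_comp _ pl'); pt.
apply: ptime_pair; first by apply: ppairs; pt.
apply: ptime_pair; last by apply: ptime_pair; apply: ppairs; pt.
apply: (ptime_map _ (f := fun _ (ef : redge (onat * onat) * redge onat) =>
  ((ef.1.1, ef.2.1), (ef.1.2.1, (ef.1.2.2, ef.2.2.2))))); last by pt.
apply: (ptime_filter _ (p := fun _ (ef : redge (onat * onat) * redge onat) =>
  ef.1.2.1.2 == ef.2.2.1)); last by pt.
apply: (ptime_allpairs (l' := fun y _ => nfa_stutters y.2)
  (f := fun _ (e : redge (onat * onat)) (f : redge onat) => (e, f))); last by pt.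
  by apply: (ptime_comp _ ptime_tr_stutters); pt.
by apply: (ptime_comp _ ptime_nfa_stutters); pt.
Qed.

Lemma ptime_identity : ptime identity.
Proof.
apply: ptime_pair; first by pt.
apply: ptime_pair; last by pt.
apply: (ptime_map (l := fun a : rmachine nat => a.2.1) _
    (f := fun _ (e : redge nat) => (e.1, ((Some e.2.1, Some e.2.1), e.2.2)))); by pt.
Qed.

Lemma ptime_tracks k : ptime (tracks k).
Proof.
apply: ptime_cons.
  apply: (ptime_comp (f := fun y => (identity y.2, y.2)) _ ptime_restrict).
  by apply: ptime_pair; [apply: (ptime_comp _ ptime_identity) |]; pt.
elim: k.+1 => [|n IH] /=; first by pt.
by apply: ptime_cons => //; apply: ptime_restrict.
Qed.

Lemma ptime_clock e : ptime (clock e).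
Proof.
apply: (ptime_map _ (f := fun _ (_ : seq nat) => tt)); last by pt.
apply: ptime_pow; do 2 (apply: ptime_cons; first by pt).
by apply: ptime_cat; pt.
Qed.

Lemma ptime_decide k e : ptime (decide k e).
Proof.
apply: ptime_negb.
apply: (ptime_comp (f := fun y => (clock e y, tracks k y)) _ (ptime_search k.+2)).
exact: ptime_pair (ptime_clock e) (ptime_tracks k).
Qed.

Lemma block_bound_mono M M' m : M <= M' -> block_bound M m <= block_bound M' m.
Proof.
move=> le_M; elim: m => //= m IH; apply: leq_mul => //.
by rewrite ltnS leq_double leq_mul.
Qed.

Lemma pump_bound_mono N N' m : N <= N' -> pump_bound N m <= pump_bound N' m.
Proof.
move=> le_N; have le_M : N.+1 * N.+1 <= N'.+1 * N'.+1 by rewrite leq_mul.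
by rewrite /pump_bound leq_mul // block_bound_mono.
Qed.

(** With [n] states in the two machines together, each of the [K] tracks is a product with at most n
    * n states. *)
Definition clock_bound (K n : nat) : nat :=
  pump_bound (2 ^ (K * K) * (n * n * K) ^ K) (K * K).

(** The closure properties of [polyb] are reused by viewing [n] as a unary list. Its encoding has
    size 2n+1, and 2n+3 <= (n+2)^2, whence the doubled exponent. *)
Lemma clock_bound_poly K : exists e, forall n, clock_bound K n <= n.+2 ^ e.
Proof.
have [e He] : polyb (fun b : seq unit => clock_bound K (size b)).
  have sb : polyb (fun b : seq unit => size b).
    by apply: polyb_le (fun b => ltnW (size_le_dsize b)) _; apply: polyb_dsize.
  have Mb : polyb (fun b : seq unit =>
      (2 ^ (K * K) * (size b * size b * K) ^ K).+1 *
      (2 ^ (K * K) * (size b * size b * K) ^ K).+1).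
    have Nb : polyb (fun b : seq unit => (2 ^ (K * K) * (size b * size b * K) ^ K).+1).
      apply: polyb_S; apply: polyb_mul; first exact: polyb_const.
      apply: polyb_exp; apply: polyb_mul; last exact: polyb_const.
      exact: polyb_mul.
    exact: polyb_mul.
  (* Only the occurrence that counts the coordinates is generalized; the one in the number of flag
     functions stays constant. *)
  apply: polyb_mul => //; elim: {3}(K * K) => [|m IH]; first exact: polyb_const.
  have Ib := polyb_mul IH (polyb_S (polyb_mul (polyb_mul IH Mb) (polyb_const 2))).
  by apply: polyb_le Ib => b; rewrite /= muln2.
exists (2 * e) => n; have := He (nseq n tt); rewrite size_nseq => le_n.
apply: leq_trans le_n _; rewrite expnM; case: (e) => // e'; rewrite leq_exp2r //.
have -> : dsize (nseq n tt) = (n.*2).+1.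
  by elim: n => //= n; rewrite dsize_cons => ->; rewrite doubleS.
by rewrite expnS expn1; nia.
Qed.

Lemma size_clock e y : size (clock e y) = (size y.1.1 + size y.2.1).+2 ^ e.
Proof. by rewrite size_map size_pow /= size_cat. Qed.

Lemma size_states_tracks k y :
  size (states (tracks k y)) <=
  (size y.1.1 + size y.2.1) * (size y.1.1 + size y.2.1) * k.+2.
Proof.
rewrite /states /tracks; move: k.+1 => K /=; rewrite size_cat size_allpairs map_nseq.
have -> n (s : seq xstate) : size (flatten (nseq n s)) = n * size s.
  by elim: n => //= n IH; rewrite size_cat IH mulSn.
by rewrite size_allpairs; nia.
Qed.

Lemma nth_tracks k y i : i < k.+1 ->
  nth xducer0 (tracks k y) i.+1 = restrict y.1 y.2.
Proof.
move=> lt_i; rewrite -[LHS]/(nth xducer0 (nseq k.+1 (restrict y.1 y.2)) i).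
by rewrite nth_nseq lt_i.
Qed.

Lemma decide_correct k : exists e, forall y : rinstance,
  wf_rmachine y.1 -> wf_rmachine y.2 ->
  ~~ decide k e y <->
  exists2 u, rlang y.2 u & exists w : nat -> seq nat,
    (forall i, i < k.+1 -> [/\ rimage y.1 u (w i), rlang y.2 (w i) & w i <> u]) /\
    forall i j, i < k.+1 -> j < k.+1 -> i != j -> w i <> w j.
Proof.
have [e He] := clock_bound_poly k.+2; exists e => y wft wfa.
rewrite negbK search_correct //; first last.
- rewrite size_clock; apply: leq_trans (He _).
  apply: pump_bound_mono; rewrite leq_mul2l; apply/orP; right.
  by rewrite leq_exp2r // size_states_tracks.
- case=> [_|i]; first exact/wf_restrict/wfa/wf_identity.
  by rewrite ltnS => lt_i; rewrite nth_tracks //; apply: wf_restrict.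
- by rewrite /= size_nseq.
have acc0 u w : xaccepts (nth xducer0 (tracks k y) 0) u w <-> rlang y.2 u /\ w = u.
  rewrite /= xaccepts_restrict // rimage_identity.
  by split=> [[[? ->] ?] | [? ->]].
have accS i u w : i < k.+1 -> xaccepts (nth xducer0 (tracks k y) i.+1) u w <->
    rimage y.1 u w /\ rlang y.2 w.
  by move=> lt_i; rewrite nth_tracks // xaccepts_restrict.
split=> [[u [w [acc dist]]] | [u uL [w [wP dist]]]].
  have [uL w0] := (acc0 u (w 0)).1 (acc 0 (ltn0Sn _)).
  exists u => //; exists (fun i => w i.+1); split=> [i lt_i | i j lt_i lt_j ne_ij].
    have [wI wL] := (accS i u (w i.+1) lt_i).1 (acc i.+1 lt_i).
    by split=> //; rewrite -w0; apply: dist.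
  exact: dist.
exists u, (fun i => if i is i'.+1 then w i' else u); split.
  case=> [_ | i lt_i]; first exact/acc0.
  by apply/accS => //; have [] := wP i lt_i.
case=> [|i] [|j] //= lt_i lt_j ne_ij.
- by have [_ _ /nesym] := wP j lt_j.
- by have [] := wP i lt_i.
- exact: dist.
Qed.

(** * Instances *)

Section CardII.
Local Open Scope classical_set_scope.
Local Open Scope card_scope.
Variables (T : eqType) (x0 : T) (A : set T) (k : nat).

Lemma card_le_IIPn : ~ (A #<= `I_k) <->
  exists w : nat -> T, (forall i, i < k.+1 -> A (w i)) /\
    forall i j, i < k.+1 -> j < k.+1 -> i != j -> w i <> w j.
Proof.
split=> [notle | [w [wA winj]] leA]; last first.
  pose s := [seq w i | i <- iota 0 k.+1].
  suff : `I_k.+1 #<= `I_k by rewrite card_le_II ltnn.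
  apply: card_le_trans leA; apply: card_le_trans _ (subset_card_le (A := w @` `I_k.+1) _).
    (* Taking the index in [s] is a left inverse of [w] below [k.+1], so the image of [w] maps onto
       [I_k.+1]. *)
    apply: card_le_trans _ (card_image_le (fun x => index x s) _).
    apply: subset_card_le => i lt_i; exists (w i); first by exists i.
    have sE : w i = nth x0 s i by rewrite (nth_map 0) ?size_iota ?nth_iota.
    rewrite -[LHS]/(index (w i) s) sE index_uniq ?size_map ?size_iota //.
    rewrite map_inj_in_uniq ?iota_uniq // => a b.
    rewrite !mem_iota => /andP[_ lt_a] /andP[_ lt_b] /eqP Eab.
    by apply/eqP; apply: contraTT Eab => ne_ab; apply/eqP/winj.
  by move=> _ [i lt_i <-]; apply: wA.
have [s [us ss sA]] : exists s : seq T,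
    [/\ uniq s, size s = k.+1 & forall x, x \in s -> A x].
  elim: {1 3}k.+1 (leqnn k.+1) => [|m IH] lt_m; first by exists [::].
  have [s [us ss sA]] := IH (ltnW lt_m).
  (* Otherwise [s] would enumerate [A] with at most [k] entries. *)
  have [x Ax xs] : exists2 x, A x & x \notin s.
    apply: contrapT => nex; apply: notle.
    apply: card_le_trans (_ : `I_m #<= `I_k); last by rewrite card_le_II.
    apply: card_le_trans _ (card_image_le (nth x0 s) _).
    apply: subset_card_le => x Ax; have x_in : x \in s.
      by apply: contrapT => /negP xs; apply: nex; exists x.
    by exists (index x s); rewrite /= ?nth_index // -ss index_mem.
  exists (x :: s); rewrite /= xs us ss; split=> // y.
  by rewrite inE => /predU1P[-> | /sA].
exists (nth x0 s); split=> [i lt_i | i j lt_i lt_j ne_ij].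
  by apply: sA; rewrite mem_nth ?ss.
by apply/eqP; rewrite nth_uniq ?ss.
Qed.

End CardII.

(** * From machines over finite types to machines over names *)

Definition rank (T : finType) (x : T) : nat := enum_rank x.

Lemma rank_inj (T : finType) : injective (@rank T).
Proof. by move=> x y /ord_inj/enum_rank_inj. Qed.

Section Raw.
Variables (label : finType) (L : eqType) (f : label -> L) (m : machine label).

Definition raw_edge (e : state m * label * state m) : redge L :=
  (rank e.1.1, (f e.1.2, rank e.2)).

Definition raw_machine : rmachine L :=
  (map (@rank _) (enum (state m)), (map raw_edge (enum (trans m)),
    (map (@rank _) (enum (init m)), map (@rank _) (enum (final m))))).

Lemma wf_raw_machine : wf_rmachine raw_machine.
Proof.
have rank_in (x : state m) : rank x \in raw_machine.1.
  by apply: map_f; rewrite mem_enum.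
by split=> [e|q|q] /mapP[x _ ->] //; rewrite /rsrc /rtgt !rank_in.
Qed.

Lemma is_path_walk p es q : is_path (m := m) p es q =
  all (mem (trans m)) es &&
  walk (@rsrc L) (@rtgt L) (rank p) (map raw_edge es) (rank q).
Proof.
elim: es p => [|e es IH] p /=; first by rewrite (inj_eq (@rank_inj _)).
rewrite IH (inj_eq (@rank_inj _)) -!andbA; congr (_ && _).
by rewrite andbCA.
Qed.

Lemma raccepting_raw es : raccepting raw_machine es <->
  exists2 es0, accepting (m := m) es0 & es = map raw_edge es0.
Proof.
split=> [[p [q [wes es_in]]] | [es0 [p [q [pI qF]]]]]; last first.
  rewrite is_path_walk => /andP[/allP es0_in wes] ->; exists (rank p), (rank q).
  split=> //; try by apply: map_f; rewrite mem_enum.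
  by move=> _ /mapP[e /es0_in e_in ->]; apply: map_f; rewrite mem_enum.
move=> /mapP[p0]; rewrite mem_enum => p0I Ep /mapP[q0]; rewrite mem_enum => q0F Eq.
have [es0 Ees es0_in] : exists2 es0, es = map raw_edge es0 & all (mem (trans m)) es0.
  elim: es es_in {wes} => [|e es IH] es_in; first by exists [::].
  have [|es0 -> es0_in] := IH.
    by move=> y y_in; apply: es_in; rewrite inE y_in orbT.
  have /mapP[e0] := es_in e (mem_head _ _); rewrite mem_enum => e0_in ->.
  by exists (e0 :: es0); rewrite //= e0_in.
exists es0 => //; exists p0, q0; split=> //.
by rewrite is_path_walk es0_in -Ees -Ep -Eq.
Qed.

End Raw.

Definition raw_io (S : finType) (xy : option S * option S) : onat * onat :=
  (omap (@rank S) xy.1, omap (@rank S) xy.2).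

Definition raw_instance (i : instance) : rinstance :=
  (raw_machine (@raw_io (alphabet i)) (inst_t i),
   raw_machine (@rank (alphabet i)) (inst_a i)).

Lemma rlang_raw (S : finType) (a : nfa S) w :
  rlang (raw_machine (@rank S) a) w <-> exists2 w0, lang a w0 & w = map (@rank S) w0.
Proof.
split=> [[es /raccepting_raw[es0 acc ->] ->] | [_ [es0 acc ->] ->]].
  exists [seq e.1.2 | e <- es0]; first by exists es0.
  by rewrite -!map_comp.
exists (map (raw_edge (@rank S) (m := a)) es0); first by apply/raccepting_raw; exists es0.
by rewrite -!map_comp.
Qed.

Lemma rimage_raw (S : finType) (t : transducer S) u v :
  rimage (raw_machine (@raw_io S) t) u v <->
  exists u0 v0, [/\ tr_image t u0 v0, u = map (@rank S) u0 & v = map (@rank S) v0].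
Proof.
have words (es : seq (state t * (option S * option S) * state t)) :
    pmap (fun e => (rlabel e).1) (map (raw_edge (@raw_io S) (m := t)) es) =
      map (@rank S) (pmap (fun e => e.1.2.1) es) /\
    pmap (fun e => (rlabel e).2) (map (raw_edge (@raw_io S) (m := t)) es) =
      map (@rank S) (pmap (fun e => e.1.2.2) es).
  by elim: es => //= -[[p [x y]] q] es [-> ->]; case: x; case: y.
split=> [[es [/raccepting_raw[es0 acc ->] -> ->]] | [u0 [v0 [[es0 [acc -> ->]] -> ->]]]].
  have [-> ->] := words es0; do 2 eexists; split; [|reflexivity|reflexivity].
  by exists es0.
exists (map (raw_edge (@raw_io S) (m := t)) es0); have [-> ->] := words es0.
by split=> //; apply/raccepting_raw; exists es0.
Qed.

Lemma inPn (k : nat) (i : instance) (y := raw_instance i) :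
  ~ inP (inst_t i) k (lang (inst_a i)) <->
  exists2 u, rlang y.2 u & exists w : nat -> seq nat,
    (forall i, i < k.+1 -> [/\ rimage y.1 u (w i), rlang y.2 (w i) & w i <> u]) /\
    forall i j, i < k.+1 -> j < k.+1 -> i != j -> w i <> w j.
Proof.
pose r := map (@rank (alphabet i)).
have r_inj : injective r by apply: inj_map; apply: rank_inj.
rewrite /y /=; split=> [notP | [u /rlang_raw[u0 u0L Eu] [w [wP winj]]] iP].
  have [u0 [u0L]] : exists u, lang (inst_a i) u /\
      ~ (tr_image (inst_t i) u `&` (lang (inst_a i) `\ u) #<= `I_k)%card%classic.
    apply: contrapT => nex; apply: notP => u uL; apply: contrapT => nle.
    by apply: nex; exists u.
  move=> /(card_le_IIPn [::])[w [wP winj]]; exists (r u0).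
    by apply/rlang_raw; exists u0.
  exists (fun j => r (w j)); split=> [j lt_j | j l lt_j lt_l ne_jl /r_inj].
    have [wt [wL wne]] := wP j lt_j; split.
    - by apply/rimage_raw; exists u0, (w j).
    - by apply/rlang_raw; exists (w j).
    - by move=> /r_inj.
  exact: winj.
have /choice[w0 w0P] : forall j, exists w0, j < k.+1 -> w j = r w0 /\
    (tr_image (inst_t i) u0 `&` (lang (inst_a i) `\ u0))%classic w0.
  move=> j; case: (ltnP j k.+1) => [/wP[] | _]; last by exists [::].
  move=> /rimage_raw[u1 [v1 [im Eu1 ->]]] /rlang_raw[v2 v2L /r_inj Ev] ne.
  rewrite Eu in Eu1 ne; move/r_inj: Eu1 => Eu1; subst u1 v2.
  by exists v1; split=> //; split=> //; split=> // E; apply: ne; rewrite E.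
suff : ~ (tr_image (inst_t i) u0 `&` (lang (inst_a i) `\ u0) #<= `I_k)%card%classic.
  by apply; apply: iP.
apply/(card_le_IIPn [::]); exists w0; split=> [j /w0P[] // | j l lt_j lt_l ne_jl E].
by apply: (winj j l lt_j lt_l ne_jl); rewrite (w0P j lt_j).1 (w0P l lt_l).1 E.
Qed.

Lemma enc_seq_map (A B : Type) {dB : data B} (g : A -> tree) (h : A -> B) (s : seq A) :
  (forall a, g a = enc (h a)) -> enc_seq g s = enc (map h s).
Proof. by move=> gh; elim: s => //= a s; rewrite gh => ->. Qed.

Lemma enc_machine_raw (label : finType) (L : eqType) {dL : data L}
    (g : label -> tree) (f : label -> L) (m : machine label) :
  (forall l, g l = enc (f l)) -> enc_machine g m = enc (raw_machine f m).
Proof.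
move=> gf; rewrite /enc_machine.
rewrite !(enc_seq_map (h := @rank (state m))) //.
rewrite (enc_seq_map (h := raw_edge f (m := m))) // => e.
by rewrite /enc_trans gf.
Qed.

(** The first component of the encoding is the alphabet, which can be arbitrarily large compared to
    [size_instance]; without it, the encoding has linear size. *)
Lemma enc_instance_raw (i : instance) :
  tl (enc_instance i) = enc (raw_instance i).
Proof.
rewrite /= (enc_machine_raw (f := @raw_io (alphabet i))).
  by rewrite (enc_machine_raw (f := @rank (alphabet i))).
by case=> [[x|] [y|]].
Qed.

Lemma dsize_map_le (A B : Type) {dB : data B} (f : A -> B) c (s : seq A) :
  (forall a, dsize (f a) <= c) -> dsize (map f s) <= size s * c.+1 + 1.
Proof.
move=> fc; elim: s => //= a s IH; rewrite dsize_cons.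
by have := fc a; nia.
Qed.

Lemma dsize_nat (n : nat) : dsize n = 1.
Proof. by []. Qed.

Lemma dsize_raw_machine (label : finType) (L : eqType) {dL : data L}
    (f : label -> L) (m : machine label) : (forall l, dsize (f l) <= 3) ->
  dsize (raw_machine f m) <= 8 * size_machine m + 10.
Proof.
move=> f3; rewrite /raw_machine !dsize_pair.
have sQ (s : seq (state m)) : dsize (map (@rank _) s) <= size s * 2 + 1.
  by apply: dsize_map_le.
(* A name takes 2 units in a list and a transition at most 8: two names, a label of size at most 3,
   two pairings and the list cell. The three lists of states together take at most 6 units per
   state. *)
have arith a b c d q r n p : a <= q * 2 + 1 -> b <= r * 8 + 1 -> c <= n * 2 + 1 ->
    d <= p * 2 + 1 -> n <= q -> p <= q ->
    (a + (b + (c + d).+1).+1).+1 <= 8 * (q + r) + 10 by lia.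
apply: (arith _ _ _ _ #|state m| #|trans m| #|init m| #|final m|).
- by rewrite cardE; apply: sQ.
- rewrite cardE; apply: dsize_map_le => e; rewrite /raw_edge !dsize_pair.
  by have := f3 e.1.2; rewrite !dsize_nat; lia.
- by rewrite cardE; apply: sQ.
- by rewrite cardE; apply: sQ.
- exact: max_card.
- exact: max_card.
Qed.

Lemma dsize_raw_instance (i : instance) :
  dsize (raw_instance i) <= 8 * size_instance i + 30.
Proof.
rewrite /raw_instance dsize_pair /size_instance.
have le_t : dsize (raw_instance i).1 <= 8 * size_machine (inst_t i) + 10.
  apply: dsize_raw_machine => -[x y].
  by rewrite /raw_io dsize_pair !dsize_onat.
have le_a : dsize (raw_instance i).2 <= 8 * size_machine (inst_a i) + 10.
  by apply: dsize_raw_machine => x; rewrite dsize_nat.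
by move: le_t le_a => /=; lia.
Qed.

Lemma poly_bound (c d e : nat) : exists p : {poly nat},
  forall n, (c * n + d) ^ e = p.[n]%R.
Proof.
elim: e => [|e [p Hp]]; first by exists 1%R => n; rewrite hornerC.
exists ((c%:P * 'X + d%:P) * p)%R => n.
by rewrite expnS Hp hornerM hornerMXaddC hornerC.
Qed.

Theorem theorem4 (k : nat) :
  poly_time_decidable size_instance enc_instance
    (fun i => inP (inst_t i) k (lang (inst_a i))).
Proof.
have [e decideP] := decide_correct k.
have [_ [T [e' He'] /(_ 0)[c cP]]] := ptime_decide k e.
(* The encoding has size at most 8n + 30, and the 2 in the base of [polyb] still fits below 8n +
   40. *)
have [p pE] := poly_bound 8 40 e'.
(* The first instruction discards the alphabet in constant time; the constant 10 pays for it. *)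
exists (Seq (Assign 0 (ETl (Var 0))) c), (p + 10%:P)%R => i.
have [|n [s' [ex le_n s'0 _]]] :=
    cP (update (input_store (enc_instance i)) 0 (tl (enc_instance i))) (raw_instance i).
  by rewrite enc_instance_raw.
exists (3 + n).+1, s'; split.
- by apply: exec_seq ex; apply: exec_assign.
- rewrite hornerD hornerC -pE.
  have : T (raw_instance i) <= (8 * size_instance i + 40) ^ e'.
    apply: leq_trans (He' _) _; case: (e') => // e''; rewrite leq_exp2r //.
    by have := dsize_raw_instance i; lia.
  by move=> le_T; apply: leq_trans (_ : (8 * size_instance i + 40) ^ e' + 10 <= _) => //; lia.
- rewrite s'0.
  have wfT := wf_raw_machine (@raw_io (alphabet i)) (inst_t i).
  have wfA := wf_raw_machine (@rank (alphabet i)) (inst_a i).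
  have := iff_trans (inPn k i) (iff_sym (decideP (raw_instance i) wfT wfA)).
  case: (decide k e (raw_instance i)) => /= -[H1 H2]; split=> //.
  - by move=> _; apply: contrapT => /H1.
  - by move/H2: isT.
Qed.
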